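(* Let $N_{\mathcal{O}_2}(\mathcal{Q}_2):=\{v\in\mathcal{Q}_2 \text{ unitary} : v\mathcal{O}_2v^*=\mathcal{O}_2\}$. The $C^*$-subalgebra of $\mathcal{Q}_2$ generated by $N_{\mathcal{O}_2}(\mathcal{Q}_2)$ is properly contained in $\mathcal{Q}_2$.
   Context: The $2$-adic ring $C^*$-algebra $\mathcal{Q}_2$ is the universal $C^*$-algebra generated by a unitary $U$ and an isometry $S_2$ such that $S_2U=U^2S_2$ and $S_2S_2^*+US_2S_2^*U^*=1$. Put $S_1:=US_2$. The Cuntz algebra $\mathcal{O}_2$ is identified with the $C^*$-subalgebra $C^*(S_1,S_2)\subset\mathcal{Q}_2$. *)

(* Defs.v *)
From HB Require Import structures.
From mathcomp Require Import all_boot all_order all_algebra.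
From mathcomp Require Import complex.
From mathcomp Require Import all_classical all_reals all_analysis.
Set Implicit Arguments.
Unset Strict Implicit.
Unset Printing Implicit Defensive.
Import Order.TTheory GRing.Theory Num.Theory.
Import numFieldNormedType.Exports.
Local Open Scope classical_set_scope.
Local Open Scope ring_scope.

(* Unital complex C*-algebras.  The norm is a field of the mixin, valued in R,
   because MathComp-Analysis has no structure combining a normed module with a
   noncommutative ring.  Algebras in MathComp satisfy 1 != 0, so the zero
   algebra is excluded. *)
HB.mixin Record isCStarAlgebra (R : realType) (A : Type)
    of GRing.Algebra R[i] A := {
  cnorm : A -> R;
  cnorm_eq0 : forall x : A, cnorm x = 0 -> x = 0;
  cnormD : forall x y : A, cnorm (x + y) <= cnorm x + cnorm y;
  cnormZ : forall (a : R[i]) (x : A),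
    cnorm (a *: x) = ComplexField.Normc.normc a * cnorm x;
  cnormM : forall x y : A, cnorm (x * y) <= cnorm x * cnorm y;
  cnorm_complete : forall u : nat -> A,
    (forall e : R, 0 < e -> exists N : nat, forall m n : nat,
       (N <= m)%N -> (N <= n)%N -> cnorm (u m - u n) < e) ->
    exists l : A, cnorm (u n - l) @[n --> \oo] --> (0 : R);
  star : A -> A;
  starK : forall x : A, star (star x) = x;
  starD : forall x y : A, star (x + y) = star x + star y;
  starZ : forall (a : R[i]) (x : A), star (a *: x) = conjc a *: star x;
  starM : forall x y : A, star (x * y) = star y * star x;
  cnorm_star : forall x : A, cnorm (star x * x) = cnorm x ^+ 2
}.

#[short(type="cstarAlgType")]
HB.structure Definition CStarAlgebra (R : realType) :=
  {A of GRing.Algebra R[i] A & isCStarAlgebra R A}.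

Section CStarAlgebraTheory.
Variables (R : realType) (A : cstarAlgType R).

Definition norm_closed (B : set A) : Prop :=
  forall (u : nat -> A) (l : A), (forall n, B (u n)) ->
    cnorm (u n - l) @[n --> \oo] --> (0 : R) -> B l.

Record cstar_subalgebra (B : set A) : Prop := CstarSubalgebra {
  cstar_sub0 : B 0;
  cstar_subD : forall x y : A, B x -> B y -> B (x + y);
  cstar_subZ : forall (a : R[i]) (x : A), B x -> B (a *: x);
  cstar_subM : forall x y : A, B x -> B y -> B (x * y);
  cstar_sub_star : forall x : A, B x -> B (star x);
  cstar_sub_closed : norm_closed B
}.

Definition cstar_generated (G : set A) : set A := smallest cstar_subalgebra G.

Definition isometry_elt (s : A) : Prop := star s * s = 1.

Definition unitary_elt (u : A) : Prop := star u * u = 1 /\ u * star u = 1.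

Definition unitary_normalizer (B : set A) : set A :=
  [set v | unitary_elt v /\ [set v * x * star v | x in B] = B].

Definition Q2_relations (U S2 : A) : Prop :=
  [/\ unitary_elt U,
      isometry_elt S2,
      S2 * U = U ^+ 2 * S2
    & S2 * star S2 + U * S2 * star S2 * star U = 1].

Definition O2 (U S2 : A) : set A := cstar_generated [set U * S2; S2].

End CStarAlgebraTheory.

(* {lrmorphism Q -> B} is the type of unital homomorphisms of complex algebras;
   no continuity is imposed, being automatic for *-homomorphisms.  Uniqueness
   of f is a consequence of the generation clause. *)
Definition is_Q2 (R : realType) (Q : cstarAlgType R) (U S2 : Q) : Prop :=
  [/\ Q2_relations U S2,
      cstar_generated [set U; S2] = setT
    & forall (B : cstarAlgType R) (V T : B), Q2_relations V T ->
        exists f : {lrmorphism Q -> B},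
          [/\ forall x : Q, f (star x) = star (f x), f U = V & f S2 = T]].

(* Main.v *)
Require Import Defs.
From HB Require Import structures.
From mathcomp Require Import all_boot all_order all_algebra.
From mathcomp Require Import complex.
From mathcomp Require Import all_classical all_reals all_analysis.
From mathcomp Require Import ring lra zify.
Set Implicit Arguments.
Unset Strict Implicit.
Unset Printing Implicit Defensive.
Import Order.TTheory GRing.Theory Num.Theory.
Import numFieldNormedType.Exports.
Local Open Scope classical_set_scope.
Local Open Scope complex_scope.
Local Open Scope ring_scope.

(** Q_2 acts on l^2(Z) by U e_k = e_(k+1) and S_2 e_k = e_(2k), hence
S_1 e_k = e_(2k+1).  Let P be the projection onto the span of the e_k with
k >= 0.  Doubling and doubling-plus-one preserve the sign of k, so P commutes
with the image of O_2; it does not commute with U, which carries e_(-1) to e_0.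
The theorem follows once every unitary v normalizing O_2 is seen to commute
with P: the elements of Q_2 commuting with P form a C*-subalgebra without U.

Let v normalize O_2 and put q = v P v*.  Conjugation by v maps O_2 onto O_2,
so q still commutes with S_1 and S_2.  Now e_0 spans the vectors fixed by S_2,
e_(-1) spans those fixed by S_1, and from these two vectors words in S_1 and
S_2 produce e_k for k >= 0 and for k < 0 respectively; thus q = a P + b (1 - P)
([commutant_diag]).  As q is a projection, a and b are 0 or 1, and a = b would
make P scalar.  The value q = P is the claim, and the remaining one,
q = 1 - P, says that v exchanges P and 1 - P.  This last case is excluded by
compactness: [U, P] has rank one and [S_2, P] = 0, so [x, P] is compact for
every x in Q_2 ([essential_commutant_cstar]), whereas for v exchanging P and
1 - P the commutator [v, P] = v (2 P - 1) is isometric on the orthonormal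
sequence e_0, e_1, ... ([unitary_no_swap]).

To use the universal property of Q_2, the bounded operators on l^2(Z) are
built as a C*-algebra: [bop H] for an abstract Hilbert space H, and l^2(I) for
an index type I through unordered sums.  The two C*-subalgebras above are
pulled back to Q_2 along the representation, which needs the representation to
be continuous.  It is contractive ([star_hom_contractive]): if |x| < 1 then
1 - x*x = y*y for a self-adjoint y ([cstar_sqrt]), and applying the
representation gives |f(x) xi|^2 = |xi|^2 - |f(y) xi|^2 for every vector xi. *)

(** * Null sequences and squared moduli *)

Section SquareNorm.
Variable R : rcfType.

Definition sqn (z : R[i]) : R := complex.Re z ^+ 2 + complex.Im z ^+ 2.

Lemma sqn_ge0 z : 0 <= sqn z.
Proof. by rewrite addr_ge0 ?sqr_ge0. Qed.

Lemma normcE_sqn (z : R[i]) : ComplexField.Normc.normc z = Num.sqrt (sqn z).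
Proof. by case: z. Qed.

Lemma conjcM_sqn (z : R[i]) : z^* * z = (sqn z)%:C.
Proof.
by case: z => a b; apply/eqP; rewrite eq_complex /sqn /=; apply/andP; split;
  apply/eqP; ring.
Qed.

End SquareNorm.

Section RealSequences.
Variable R : realType.
Implicit Types u v : nat -> R.

Lemma squeeze0 u v : (forall n, 0 <= u n <= v n) ->
  v n @[n --> \oo] --> (0 : R) -> u n @[n --> \oo] --> (0 : R).
Proof.
move=> uv v0; apply: (@squeeze_cvgr _ _ _ _ (fun=> 0) v) => //.
  by apply: nearW.
exact: cvg_cst.
Qed.

Lemma cvg0_sqr u :
  u n ^+ 2 @[n --> \oo] --> (0 : R) -> u n @[n --> \oo] --> (0 : R).
Proof.
move=> u0; apply/cvgrPdist_lt => e e0.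
have /cvgrPdist_lt/(_ _ (exprn_gt0 2 e0))[N _ hN] := u0.
exists N => // n /hN /=; rewrite !sub0r !normrN normrX.
by rewrite ltr_pXn2r ?nnegrE// ltW.
Qed.

End RealSequences.

(** * Hilbert spaces *)

(** Over the complex numbers, with [ip] the real part of the inner product; it
determines the inner product, and [ipJ] is what makes adjoints with respect to
[ip] of complex linear maps complex linear.  Working with a real-valued form
avoids limits of complex sequences.  The zero space is excluded because its
operators form the zero ring. *)
Record hilbert (R : realType) := Hilbert {
  hcar :> lmodType R[i];
  ip : hcar -> hcar -> R;
  ipC : forall x y, ip x y = ip y x;
  ipDl : forall x y z, ip (x + y) z = ip x z + ip y z;
  ipZl : forall (a : R) x y, ip (a%:C *: x) y = a * ip x y;
  ipJ : forall (a : R[i]) x y, ip (a *: x) y = ip x (a^* *: y);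
  ip_ge0 : forall x, 0 <= ip x x;
  ip_eq0 : forall x, ip x x = 0 -> x = 0;
  hilbert_complete : forall u : nat -> hcar,
    (forall e : R, 0 < e -> exists N, forall m n, (N <= m)%N -> (N <= n)%N ->
       Num.sqrt (ip (u m - u n) (u m - u n)) < e) ->
    exists l, Num.sqrt (ip (u n - l) (u n - l)) @[n --> \oo] --> (0 : R);
  hilbert_nontrivial : exists x : hcar, x != 0
}.

Section HilbertTheory.
Variables (R : realType) (H : hilbert R).
Implicit Types x y z : H.

Definition hnorm x : R := Num.sqrt (ip x x).

Lemma hnorm_ge0 x : 0 <= hnorm x.
Proof. exact: sqrtr_ge0. Qed.

Lemma sqr_hnorm x : hnorm x ^+ 2 = ip x x.
Proof. by rewrite sqr_sqrtr// ip_ge0. Qed.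

Lemma hnorm_eq0 x : hnorm x = 0 -> x = 0.
Proof. by move=> x0; apply: ip_eq0; rewrite -sqr_hnorm x0 expr0n. Qed.

Lemma ip0l x : ip 0 x = 0.
Proof.
have -> : ip 0 x = ip ((0 : R)%:C *: (0 : H)) x by rewrite scaler0.
by rewrite ipZl mul0r.
Qed.

Lemma ipNl x y : ip (- x) y = - ip x y.
Proof.
by apply/eqP; rewrite -addr_eq0 -ipDl addNr ip0l.
Qed.

Lemma ipBl x y z : ip (x - y) z = ip x z - ip y z.
Proof. by rewrite ipDl ipNl. Qed.

Lemma ip0r x : ip x 0 = 0.
Proof. by rewrite ipC ip0l. Qed.

Lemma ipDr x y z : ip z (x + y) = ip z x + ip z y.
Proof. by rewrite ipC ipDl ipC [ip y z]ipC. Qed.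

Lemma ipNr x y : ip x (- y) = - ip x y.
Proof. by rewrite ipC ipNl ipC. Qed.

Lemma ipBr x y z : ip z (x - y) = ip z x - ip z y.
Proof. by rewrite ipDr ipNr. Qed.

Lemma ipZr (a : R) x y : ip x (a%:C *: y) = a * ip x y.
Proof. by rewrite ipC ipZl ipC. Qed.

Lemma ip_inj x y : (forall z, ip x z = ip y z) -> x = y.
Proof.
move=> xy; apply/eqP; rewrite -subr_eq0; apply/eqP/ip_eq0.
by rewrite ipBl xy subrr.
Qed.

Lemma hnorm0 : hnorm 0 = 0.
Proof. by rewrite /hnorm ip0l sqrtr0. Qed.

Lemma hnormN x : hnorm (- x) = hnorm x.
Proof. by rewrite /hnorm ipNl ipNr opprK. Qed.

Lemma hnormB x y : hnorm (x - y) = hnorm (y - x).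
Proof. by rewrite -hnormN opprB. Qed.

Lemma hnormZ (a : R[i]) x :
  hnorm (a *: x) = ComplexField.Normc.normc a * hnorm x.
Proof.
rewrite /hnorm ipJ scalerA conjcM_sqn ipZr sqrtrM ?sqn_ge0//.
by rewrite normcE_sqn.
Qed.

(** Positivity of the form at |y| x - |x| y. *)
Lemma cauchy_schwarz x y : ip x y <= hnorm x * hnorm y.
Proof.
have [x0|x0] := eqVneq (hnorm x) 0.
  by rewrite (hnorm_eq0 x0) ip0l hnorm0 mul0r.
have [y0|y0] := eqVneq (hnorm y) 0.
  by rewrite (hnorm_eq0 y0) ip0r hnorm0 mulr0.
have xp : 0 < hnorm x by rewrite lt_def x0 hnorm_ge0.
have yp : 0 < hnorm y by rewrite lt_def y0 hnorm_ge0.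
have := ip_ge0 ((hnorm y)%:C *: x - (hnorm x)%:C *: y).
rewrite ipBl !ipBr !ipZl !ipZr -!sqr_hnorm [ip y x]ipC => h.
rewrite -(ler_pM2l (mulr_gt0 xp yp)).
nra.
Qed.

Lemma ip_abs_le x y : `|ip x y| <= hnorm x * hnorm y.
Proof.
rewrite ler_norml cauchy_schwarz andbT lerNl -ipNl -[hnorm x]hnormN.
exact: cauchy_schwarz.
Qed.

Lemma hnormD x y : hnorm (x + y) <= hnorm x + hnorm y.
Proof.
rewrite -(@ler_pXn2r _ 2)// ?nnegrE ?addr_ge0 ?hnorm_ge0//.
rewrite sqr_hnorm ipDl !ipDr [ip y x]ipC sqrrD !sqr_hnorm.
have := cauchy_schwarz x y; lra.
Qed.

Lemma hnorm_triB x y z : hnorm (x - z) <= hnorm (x - y) + hnorm (y - z).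
Proof. by rewrite (le_trans _ (hnormD _ _))// addrA subrK. Qed.

Definition hcvg (u : nat -> H) l := hnorm (u n - l) @[n --> \oo] --> (0 : R).

Lemma hcvg_ip u l y : hcvg u l -> ip (u n) y @[n --> \oo] --> ip l y.
Proof.
move=> ul; apply/subr_cvg0.
apply: norm_cvg0.
apply: (@squeeze0 _ _ (fun n => hnorm (u n - l) * hnorm y)) => [n|].
  by rewrite normr_ge0 -ipBl ip_abs_le.
by rewrite -(mul0r (hnorm y)); apply: cvgMl.
Qed.

Lemma hcvg_le u l z C N : hcvg u l ->
  (forall n, (N <= n)%N -> hnorm (z - u n) <= C) -> hnorm (z - l) <= C.
Proof.
move=> ul uz; apply/ler_addgt0Pl => e e0.
have /cvgrPdist_lt/(_ _ e0) := ul; case=> M _ hM.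
have := hM (maxn M N) (leq_maxl _ _); rewrite sub0r normrN ger0_norm ?hnorm_ge0//.
move=> h; apply: le_trans (hnorm_triB _ (u (maxn M N)) _) _.
by rewrite addrC lerD//; [exact: ltW | rewrite uz// leq_maxr].
Qed.

Lemma hcvg_unique u l l' : hcvg u l -> hcvg u l' -> l = l'.
Proof.
move=> ul ul'; apply: ip_inj => z.
rewrite -(cvg_lim (@Rhausdorff R) (hcvg_ip (y := z) ul)).
exact: (cvg_lim (@Rhausdorff R) (hcvg_ip (y := z) ul')).
Qed.

Lemma hcvgZ u l (a : R[i]) : hcvg u l -> hcvg (fun n => a *: u n) (a *: l).
Proof.
move=> ul; rewrite /hcvg.
under eq_fun => n do rewrite -scalerBr hnormZ.
by rewrite -(mulr0 (ComplexField.Normc.normc a)); apply: cvgMr.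
Qed.

End HilbertTheory.

(** * The C*-algebra of bounded operators *)

Section BoundedOperators.
Variables (R : realType) (H : hilbert R).
Notation normc := ComplexField.Normc.normc.

(** The adjoint is carried as data, so that the involution merely exchanges the
two maps and no representation theorem for functionals is needed.  Additivity
is a consequence of [bop_ip] and nondegeneracy of [ip]. *)
Record bop := Bop {
  bop_app :> H -> H;
  bop_adj : H -> H;
  bop_ip : forall x y, ip (bop_app x) y = ip x (bop_adj y);
  bopZ : forall a x, bop_app (a *: x) = a *: bop_app x;
  bop_bounded : exists M, forall x, hnorm (bop_app x) <= M * hnorm x
}.

Implicit Types S T : bop.

Lemma bop_ipr T x y : ip x (T y) = ip (bop_adj T x) y.
Proof. by rewrite ipC bop_ip ipC. Qed.

(** Adjoints are unique, so equality of the underlying maps is enough. *)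
Lemma bop_ext S T : (forall x, S x = T x) -> S = T.
Proof.
move=> ST; have e1 : bop_app S = bop_app T by apply/funext.
have e2 : bop_adj S = bop_adj T.
  apply/funext => y; apply: ip_inj => z.
  by rewrite ipC [ip (bop_adj T _) _]ipC -!bop_ip ST.
case: S T e1 e2 {ST} => [f f' p q r] [g g' p' q' r'] /= e1 e2.
move: p q r p' q' r'; rewrite e1 e2 => p q r p' q' r'.
by congr Bop; exact: Prop_irrelevance.
Qed.

Lemma bopD T x y : T (x + y) = T x + T y.
Proof. by apply: ip_inj => z; rewrite ipDl !bop_ip ipDl. Qed.

Lemma bop0 T : T 0 = 0.
Proof. by apply: ip_inj => z; rewrite bop_ip !ip0l. Qed.

Lemma bopN T x : T (- x) = - T x.
Proof. by apply: ip_inj => z; rewrite ipNl !bop_ip ipNl. Qed.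

Lemma bop_bounded_ge0 T :
  exists2 M, 0 <= M & forall x, hnorm (T x) <= M * hnorm x.
Proof.
have [M TM] := bop_bounded T; exists (Num.max 0 M); first by rewrite le_max lexx.
move=> x; apply: le_trans (TM x) _.
by rewrite ler_wpM2r ?hnorm_ge0// le_max lexx orbT.
Qed.

(** From |T* y|^2 = <T T* y, y>. *)
Lemma adj_bound T M : 0 <= M -> (forall x, hnorm (T x) <= M * hnorm x) ->
  forall y, hnorm (bop_adj T y) <= M * hnorm y.
Proof.
move=> M0 TM y; have [->|y0] := eqVneq (hnorm (bop_adj T y)) 0.
  by rewrite mulr_ge0 ?hnorm_ge0.
have yp : 0 < hnorm (bop_adj T y) by rewrite lt_def y0 hnorm_ge0.
rewrite -(ler_pM2l yp) -expr2 sqr_hnorm -bop_ip.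
apply: le_trans (cauchy_schwarz _ _) _.
by rewrite mulrA [_ * M]mulrC ler_wpM2r ?hnorm_ge0.
Qed.

Fact bop_zero_subproof : exists M, forall x : H, hnorm (0 : H) <= M * hnorm x.
Proof. by exists 0 => x; rewrite mul0r hnorm0. Qed.
Definition bop_zero := @Bop (fun=> 0) (fun=> 0)
  (fun x y => etrans (ip0l y) (esym (ip0r x)))
  (fun a x => esym (scaler0 _ a)) bop_zero_subproof.

Fact bop_id_subproof : exists M, forall x : H, hnorm x <= M * hnorm x.
Proof. by exists 1 => x; rewrite mul1r. Qed.
Definition bop_id := @Bop id id (fun x y => erefl) (fun a x => erefl)
  bop_id_subproof.

Fact bop_add_ip S T x y : ip (S x + T x) y = ip x (bop_adj S y + bop_adj T y).
Proof. by rewrite ipDl ipDr !bop_ip. Qed.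
Fact bop_addZ S T a x : S (a *: x) + T (a *: x) = a *: (S x + T x).
Proof. by rewrite !bopZ scalerDr. Qed.
Fact bop_add_bounded S T :
  exists M, forall x, hnorm (S x + T x) <= M * hnorm x.
Proof.
have [M SM] := bop_bounded S; have [L TL] := bop_bounded T.
by exists (M + L) => x; rewrite (le_trans (hnormD _ _))// mulrDl lerD.
Qed.
Definition bop_add S T := Bop (@bop_add_ip S T) (@bop_addZ S T)
  (bop_add_bounded S T).

Fact bop_opp_ip T x y : ip (- T x) y = ip x (- bop_adj T y).
Proof. by rewrite ipNl ipNr bop_ip. Qed.
Fact bop_oppZ T a x : - T (a *: x) = a *: (- T x).
Proof. by rewrite bopZ scalerN. Qed.
Fact bop_opp_bounded T : exists M, forall x, hnorm (- T x) <= M * hnorm x.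
Proof.
by have [M TM] := bop_bounded T; exists M => x; rewrite hnormN.
Qed.
Definition bop_opp T := Bop (@bop_opp_ip T) (@bop_oppZ T) (bop_opp_bounded T).

Fact bop_scale_ip (a : R[i]) T x y : ip (a *: T x) y = ip x (bop_adj T (a^* *: y)).
Proof. by rewrite ipJ bop_ip. Qed.
Fact bop_scaleZ (a : R[i]) T b x : a *: T (b *: x) = b *: (a *: T x).
Proof. by rewrite bopZ !scalerA mulrC. Qed.
Fact bop_scale_bounded (a : R[i]) T :
  exists M, forall x, hnorm (a *: T x) <= M * hnorm x.
Proof.
have [M TM] := bop_bounded T; exists (normc a * M) => x.
by rewrite hnormZ -mulrA ler_wpM2l// normcE_sqn sqrtr_ge0.
Qed.
Definition bop_scale a T := Bop (@bop_scale_ip a T) (@bop_scaleZ a T)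
  (bop_scale_bounded a T).

Fact bop_mul_ip S T x y : ip (S (T x)) y = ip x (bop_adj T (bop_adj S y)).
Proof. by rewrite !bop_ip. Qed.
Fact bop_mulZ S T a x : S (T (a *: x)) = a *: S (T x).
Proof. by rewrite !bopZ. Qed.
Fact bop_mul_bounded S T : exists M, forall x, hnorm (S (T x)) <= M * hnorm x.
Proof.
have [M M0 SM] := bop_bounded_ge0 S; have [L TL] := bop_bounded T.
exists (M * L) => x; apply: le_trans (SM _) _.
by rewrite -mulrA ler_wpM2l.
Qed.
Definition bop_mul S T := Bop (@bop_mul_ip S T) (@bop_mulZ S T)
  (bop_mul_bounded S T).

Fact bop_star_ip T x y : ip (bop_adj T x) y = ip x (T y).
Proof. by rewrite -bop_ipr. Qed.
Fact bop_starZ T a x : bop_adj T (a *: x) = a *: bop_adj T x.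
Proof.
apply: ip_inj => z.
by rewrite ipJ !bop_star_ip ipJ bopZ.
Qed.
Fact bop_star_bounded T : exists M, forall x, hnorm (bop_adj T x) <= M * hnorm x.
Proof.
by have [M M0 TM] := bop_bounded_ge0 T; exists M; apply: adj_bound.
Qed.
Definition bop_star T := Bop (@bop_star_ip T) (@bop_starZ T)
  (bop_star_bounded T).

HB.instance Definition _ := gen_eqMixin bop.
HB.instance Definition _ := gen_choiceMixin bop.

Fact bop_addA : associative bop_add.
Proof. by move=> S T W; apply: bop_ext => x /=; rewrite addrA. Qed.
Fact bop_addC : commutative bop_add.
Proof. by move=> S T; apply: bop_ext => x /=; rewrite addrC. Qed.
Fact bop_add0 : left_id bop_zero bop_add.
Proof. by move=> S; apply: bop_ext => x /=; rewrite add0r. Qed.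
Fact bop_addN : left_inverse bop_zero bop_opp bop_add.
Proof. by move=> S; apply: bop_ext => x /=; rewrite addNr. Qed.
HB.instance Definition _ := GRing.isZmodule.Build bop
  bop_addA bop_addC bop_add0 bop_addN.

Fact bop_mulA : associative bop_mul.
Proof. by move=> S T W; apply: bop_ext. Qed.
Fact bop_mul1 : left_id bop_id bop_mul.
Proof. by move=> S; apply: bop_ext. Qed.
Fact bop_mulr1 : right_id bop_id bop_mul.
Proof. by move=> S; apply: bop_ext. Qed.
Fact bop_mulDl : left_distributive bop_mul +%R.
Proof. by move=> S T W; apply: bop_ext. Qed.
Fact bop_mulDr : right_distributive bop_mul +%R.
Proof. by move=> S T W; apply: bop_ext => x /=; rewrite bopD. Qed.
Fact bop_one_neq0 : bop_id != 0.
Proof.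
have [x x0] := hilbert_nontrivial H; apply/eqP => /(congr1 (fun T : bop => T x)).
by move=> /= x0'; rewrite x0' eqxx in x0.
Qed.
HB.instance Definition _ := GRing.Zmodule_isNzRing.Build bop
  bop_mulA bop_mul1 bop_mulr1 bop_mulDl bop_mulDr bop_one_neq0.

Fact bop_scalerA a b T : bop_scale a (bop_scale b T) = bop_scale (a * b) T.
Proof. by apply: bop_ext => x /=; rewrite scalerA. Qed.
Fact bop_scale1 : left_id 1 bop_scale.
Proof. by move=> T; apply: bop_ext => x /=; rewrite scale1r. Qed.
Fact bop_scalerDr : right_distributive bop_scale +%R.
Proof. by move=> a S T; apply: bop_ext => x /=; rewrite scalerDr. Qed.
Fact bop_scalerDl T : {morph bop_scale^~ T : a b / a + b}.
Proof. by move=> a b; apply: bop_ext => x /=; rewrite scalerDl. Qed.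
HB.instance Definition _ := GRing.Zmodule_isLmodule.Build R[i] bop
  bop_scalerA bop_scale1 bop_scalerDr bop_scalerDl.

Fact bop_scalerAl (a : R[i]) S T : a *: (S * T) = (a *: S) * T.
Proof. by apply: bop_ext. Qed.
HB.instance Definition _ := GRing.Lmodule_isLalgebra.Build R[i] bop bop_scalerAl.
Fact bop_scalerAr (a : R[i]) S T : a *: (S * T) = S * (a *: T).
Proof. by apply: bop_ext => x /=; rewrite bopZ. Qed.
HB.instance Definition _ := GRing.Lalgebra_isAlgebra.Build R[i] bop bop_scalerAr.

Definition opnorm T : R :=
  inf [set M | 0 <= M /\ forall x, hnorm (T x) <= M * hnorm x].

Let has_inf_opnorm T :
  has_inf [set M | 0 <= M /\ forall x, hnorm (T x) <= M * hnorm x].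
Proof.
split; first by have [M M0 TM] := bop_bounded_ge0 T; exists M.
by exists 0 => M [].
Qed.

Lemma opnorm_ge0 T : 0 <= opnorm T.
Proof. by apply: lb_le_inf; [case: (has_inf_opnorm T) | move=> M []]. Qed.

Lemma opnorm_le T M : 0 <= M -> (forall x, hnorm (T x) <= M * hnorm x) ->
  opnorm T <= M.
Proof. by move=> M0 TM; apply: ge_inf; [case: (has_inf_opnorm T) | split]. Qed.

Lemma opnormP T x : hnorm (T x) <= opnorm T * hnorm x.
Proof.
have [x0|x0] := eqVneq (hnorm x) 0.
  by rewrite (hnorm_eq0 x0) bop0 hnorm0 mulr0.
have xp : 0 < hnorm x by rewrite lt_def x0 hnorm_ge0.
rewrite -ler_pdivrMr//; apply: lb_le_inf; first by case: (has_inf_opnorm T).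
by move=> M [_ TM]; rewrite ler_pdivrMr.
Qed.

Fact opnorm_eq0 T : opnorm T = 0 -> T = 0.
Proof.
move=> T0; apply: bop_ext => x; apply: hnorm_eq0; apply/eqP.
by rewrite eq_le hnorm_ge0 andbT (le_trans (opnormP _ _))// T0 mul0r.
Qed.

Fact opnormD S T : opnorm (S + T) <= opnorm S + opnorm T.
Proof.
apply: opnorm_le => [|x]; first by rewrite addr_ge0 ?opnorm_ge0.
by rewrite mulrDl (le_trans (hnormD _ _))// lerD ?opnormP.
Qed.

Let opnormZ_le (a : R[i]) T : opnorm (a *: T) <= normc a * opnorm T.
Proof.
have a0 : 0 <= normc a by rewrite normcE_sqn sqrtr_ge0.
apply: opnorm_le => [|x]; first by rewrite mulr_ge0 ?opnorm_ge0.
by rewrite hnormZ -mulrA ler_wpM2l ?opnormP.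
Qed.

Fact opnormZ (a : R[i]) T : opnorm (a *: T) = normc a * opnorm T.
Proof.
apply/eqP; rewrite eq_le opnormZ_le /=.
have [->|a0] := eqVneq a 0.
  by rewrite ComplexField.Normc.normc0 mul0r opnorm_ge0.
have na0 : 0 < normc a.
  rewrite lt_def normcE_sqn sqrtr_ge0 andbT -normcE_sqn.
  by apply: contra a0 => /eqP/ComplexField.Normc.eq0_normc ->.
rewrite -ler_pdivlMl// -ComplexField.Normc.normcV.
by rewrite -[X in opnorm X <= _](scalerK a0) opnormZ_le.
Qed.

Fact opnormM S T : opnorm (S * T) <= opnorm S * opnorm T.
Proof.
apply: opnorm_le => [|x]; first by rewrite mulr_ge0 ?opnorm_ge0.
apply: le_trans (opnormP S (T x)) _.
by rewrite -mulrA ler_wpM2l ?opnormP ?opnorm_ge0.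
Qed.

Let opnorm_star_le T : opnorm (bop_star T) <= opnorm T.
Proof.
apply: opnorm_le; first exact: opnorm_ge0.
by apply: adj_bound; [exact: opnorm_ge0 | exact: opnormP].
Qed.

Fact bop_starK T : bop_star (bop_star T) = T.
Proof. exact: bop_ext. Qed.

Lemma opnorm_star T : opnorm (bop_star T) = opnorm T.
Proof.
apply/eqP; rewrite eq_le opnorm_star_le /=.
by rewrite -{1}[T]bop_starK opnorm_star_le.
Qed.

Fact bop_starD S T : bop_star (S + T) = bop_star S + bop_star T.
Proof. exact: bop_ext. Qed.

Fact bop_star_scale (a : R[i]) T : bop_star (a *: T) = a^* *: bop_star T.
Proof. by apply: bop_ext => x /=; rewrite bop_starZ. Qed.

Fact bop_starM S T : bop_star (S * T) = bop_star T * bop_star S.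
Proof. exact: bop_ext. Qed.

(** The nontrivial inequality is |T x|^2 = <T* T x, x> <= |T* T| |x|^2. *)
Fact opnorm_starM T : opnorm (bop_star T * T) = opnorm T ^+ 2.
Proof.
apply/eqP; rewrite eq_le; apply/andP; split.
  by rewrite (le_trans (opnormM _ _))// opnorm_star.
set C := opnorm (bop_star T * T); have C0 : 0 <= C by exact: opnorm_ge0.
rewrite -[C]sqr_sqrtr// ler_pXn2r ?nnegrE ?sqrtr_ge0 ?opnorm_ge0//.
apply: opnorm_le => [|x]; first exact: sqrtr_ge0.
rewrite -(@ler_pXn2r _ 2)// ?nnegrE ?mulr_ge0 ?sqrtr_ge0 ?hnorm_ge0//.
rewrite exprMn (sqr_sqrtr C0) !sqr_hnorm bop_ip ipC -[ip x x]sqr_hnorm.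
apply: le_trans (cauchy_schwarz _ _) _.
by rewrite expr2 mulrA ler_wpM2r ?hnorm_ge0//; exact: (opnormP (bop_star T * T)).
Qed.

Lemma bop_pointwise_limit (u : nat -> bop) :
  (forall e : R, 0 < e -> exists N, forall m n, (N <= m)%N -> (N <= n)%N ->
     opnorm (u m - u n) < e) ->
  forall x, exists l, hcvg (fun n => u n x) l.
Proof.
move=> uC x; apply: hilbert_complete => e e0.
have e0' : 0 < e / (1 + hnorm x) by rewrite divr_gt0// ltr_wpDr ?hnorm_ge0.
have [N uN] := uC _ e0'; exists N => m n Nm Nn.
apply: (@le_lt_trans _ _ (opnorm (u m - u n) * hnorm x)).
  exact: (opnormP (u m - u n)).
apply: (@le_lt_trans _ _ (e / (1 + hnorm x) * hnorm x)).
  by rewrite ler_wpM2r ?hnorm_ge0// ltW// uN.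
rewrite mulrAC ltr_pdivrMr ?ltr_wpDr ?hnorm_ge0//.
by rewrite ltr_pM2l// ltrDr.
Qed.

(** A Cauchy sequence of operators and the sequence of its adjoints both
converge pointwise, and the two limits are adjoint to each other. *)
Fact opnorm_complete (u : nat -> bop) :
  (forall e : R, 0 < e -> exists N, forall m n, (N <= m)%N -> (N <= n)%N ->
     opnorm (u m - u n) < e) ->
  exists l, opnorm (u n - l) @[n --> \oo] --> (0 : R).
Proof.
move=> uC.
have uC' (e : R) : 0 < e -> exists N, forall m n, (N <= m)%N -> (N <= n)%N ->
     opnorm (bop_star (u m) - bop_star (u n)) < e.
  move=> /uC[N uN]; exists N => m n Nm Nn.
  rewrite (_ : _ - _ = bop_star (u m - u n)); last exact: bop_ext.
  by rewrite opnorm_star uN.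
have [f fP] := choice (bop_pointwise_limit uC).
have [g gP] := choice (bop_pointwise_limit uC').
have near_f e N x : (forall m n, (N <= m)%N -> (N <= n)%N ->
    opnorm (u m - u n) < e) ->
    forall m, (N <= m)%N -> hnorm (u m x - f x) <= e * hnorm x.
  move=> uN m Nm; apply: (hcvg_le (N := N) (fP x)) => n Nn.
  apply: le_trans (opnormP (u m - u n) x) _.
  by rewrite ler_wpM2r ?hnorm_ge0// ltW// uN.
have f_ip x y : ip (f x) y = ip x (g y).
  rewrite -(cvg_lim (@Rhausdorff R) (hcvg_ip (y := y) (fP x))).
  apply: (cvg_lim (@Rhausdorff R)).
  rewrite ipC -(_ : (fun n => ip (bop_adj (u n) y) x) = (fun n => ip (u n x) y)).
    exact: (hcvg_ip (y := x) (gP y)).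
  by apply/funext => n; rewrite -bop_ipr ipC.
have fZ a x : f (a *: x) = a *: f x.
  apply: (hcvg_unique (fP (a *: x))).
  rewrite (_ : (fun _ => _) = (fun n => a *: u n x)); last first.
    by apply/funext => n; rewrite bopZ.
  exact: hcvgZ.
have f_bounded : exists M, forall x, hnorm (f x) <= M * hnorm x.
  have [N uN] := uC _ (@ltr01 R); have [M uM] := bop_bounded (u N).
  exists (M + 1) => x; rewrite -[f x](subrK (u N x)) addrC mulrDl.
  apply: le_trans (hnormD _ _) _; rewrite lerD// hnormB.
  exact: near_f uN _ (leqnn N).
exists (Bop f_ip fZ f_bounded); apply/cvgrPdist_le => e e0.
have [N uN] := uC _ e0; exists N => // n Nn /=.
rewrite sub0r normrN ger0_norm ?opnorm_ge0//.
by apply: opnorm_le => [|x]; [exact: ltW | exact: near_f uN _ Nn].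
Qed.

HB.instance Definition _ := isCStarAlgebra.Build R bop
  opnorm_eq0 opnormD opnormZ opnormM opnorm_complete
  bop_starK bop_starD bop_star_scale bop_starM opnorm_starM.

End BoundedOperators.

(** * Unordered sums of real families *)

Section UnorderedSums.
Variables (R : realType) (I : choiceType).
Implicit Types f g a b : I -> R.

Definition esumR f : \bar R := \esum_(i in [set: I]) (f i)%:E.
Definition asum f := (esumR (fun i => `|f i|%R) < +oo)%E.
(** Only meaningful for nonnegative summable families. *)
Definition nsum f : R := fine (esumR f).

Lemma esumR_ge0 f : (forall i, 0 <= f i) -> (0 <= esumR f)%E.
Proof. by move=> f0; apply: esum_ge0 => i _; rewrite lee_fin. Qed.

Lemma esumRD f g : (forall i, 0 <= f i) -> (forall i, 0 <= g i) ->
  esumR (f \+ g) = (esumR f + esumR g)%E.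
Proof. by move=> f0 g0; rewrite -esumD// => i _; rewrite lee_fin. Qed.

Lemma esumR_finite f (M : R) :
  (forall s : seq I, uniq s -> \sum_(i <- s) f i <= M) -> (esumR f <= M%:E)%E.
Proof.
move=> fM; apply: ge_ereal_sup => _ [F [finF _] <-].
rewrite fsbig_finite//= sumEFin lee_fin; apply: fM; exact: finmap.fset_uniq.
Qed.

Lemma esumR_sum f (s : seq I) : (forall i, 0 <= f i) -> uniq s ->
  ((\sum_(i <- s) f i)%:E <= esumR f)%E.
Proof.
move=> f0 us; apply: esum_ge; exists [set` s]; first by split.
by rewrite -fsbig_seq// sumEFin.
Qed.

Let esumRZ_le (c : R) f : 0 <= c -> (forall i, 0 <= f i) ->
  (esumR (fun i => (c * f i)%R) <= c%:E * esumR f)%E.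
Proof.
move=> c0 f0; apply: ge_ereal_sup => _ [F [finF _] <-].
rewrite fsbig_finite//= sumEFin -mulr_sumr EFinM lee_wpmul2l ?lee_fin//.
by apply: esumR_sum => //; exact: finmap.fset_uniq.
Qed.

Lemma esumRZ (c : R) f : 0 <= c -> (forall i, 0 <= f i) ->
  esumR (fun i => c * f i) = (c%:E * esumR f)%E.
Proof.
move=> c0 f0; apply/eqP; rewrite eq_le esumRZ_le//=.
have [->|cn0] := eqVneq c 0.
  by rewrite mul0e esumR_ge0// => i; rewrite mul0r.
have cp : 0 < c by rewrite lt_def cn0.
rewrite -lee_pdivlMl//.
rewrite [X in (X <= _)%E](_ : _ = esumR (fun i => (c^-1 * (c * f i))%R)).
  by apply: esumRZ_le => [|i]; rewrite ?invr_ge0 ?mulr_ge0.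
by congr esumR; apply/funext => i; rewrite mulKf.
Qed.

Lemma le_esumR f g : (forall i, f i <= g i) -> (esumR f <= esumR g)%E.
Proof. by move=> fg; apply: le_esum => i _; rewrite lee_fin. Qed.

Lemma asum_le f g : (forall i, `|f i| <= g i) -> asum g -> asum f.
Proof.
move=> fg; apply: le_lt_trans; apply: le_esumR => i.
exact: le_trans (fg i) (ler_norm _).
Qed.

Lemma asumD f g : asum f -> asum g -> asum (f \+ g).
Proof.
move=> sf sg; rewrite /asum; apply: (@le_lt_trans _ _
    (esumR ((fun i => `|f i|) \+ (fun i => `|g i|)))).
  by apply: le_esumR => i; exact: ler_normD.
by rewrite esumRD// lte_add_pinfty.
Qed.

Lemma asumZ (c : R) f : asum f -> asum (fun i => c * f i).
Proof.
rewrite /asum => sf; rewrite (_ : (fun i => `|c * f i|) = (fun i => `|c| * `|f i|)).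
  by rewrite esumRZ// lte_mul_pinfty// lee_fin.
by apply/funext => i; rewrite normrM.
Qed.

Lemma asum_norm f : asum f -> asum (fun i => `|f i|).
Proof.
by rewrite /asum => sf; under [X in esumR X]eq_fun => i do rewrite normr_id.
Qed.

Lemma ge0_normE f : (forall i, 0 <= f i) -> (fun i => `|f i|) = f.
Proof. by move=> f0; apply/funext => i; rewrite ger0_norm. Qed.

Lemma nsumEFin f : (forall i, 0 <= f i) -> asum f -> (nsum f)%:E = esumR f.
Proof.
move=> f0; rewrite /asum ge0_normE// => sf.
by rewrite /nsum fineK// ge0_fin_numE ?esumR_ge0.
Qed.

Lemma nsumD f g : (forall i, 0 <= f i) -> (forall i, 0 <= g i) ->
  asum f -> asum g -> nsum (f \+ g) = nsum f + nsum g.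
Proof.
move=> f0 g0 sf sg; apply: EFin_inj; rewrite EFinD !nsumEFin ?esumRD//.
  by move=> i /=; rewrite addr_ge0.
exact: asumD.
Qed.

Lemma nsumZ (c : R) f : 0 <= c -> (forall i, 0 <= f i) -> asum f ->
  nsum (fun i => c * f i) = c * nsum f.
Proof.
move=> c0 f0 sf; apply: EFin_inj; rewrite EFinM !nsumEFin ?esumRZ//.
  by move=> i; rewrite mulr_ge0.
exact: asumZ.
Qed.

Lemma nsum_ge0 f : (forall i, 0 <= f i) -> 0 <= nsum f.
Proof. by move=> f0; rewrite fine_ge0// esumR_ge0. Qed.

Lemma le_nsum f i : (forall i, 0 <= f i) -> asum f -> f i <= nsum f.
Proof.
move=> f0 sf; rewrite -lee_fin nsumEFin//.
by have := esumR_sum (s := [:: i]) f0 isT; rewrite big_seq1.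
Qed.

(** The sum of an absolutely summable family of any sign, as a difference of two
sums of nonnegative families. *)
Definition rsum f : R := nsum (fun i => `|f i| + f i) - nsum (fun i => `|f i|).

Let posp_ge0 f i : 0 <= `|f i| + f i.
Proof. by have := lerNnormlW (lexx `|f i|); rewrite -lerBlDl sub0r. Qed.

Let posp_asum f : asum f -> asum (fun i => `|f i| + f i).
Proof. by move=> sf; apply: asumD => //; exact: asum_norm. Qed.

(** Independence of the decomposition: linearity of [rsum] reduces to additivity
of [nsum] on nonnegative families. *)
Lemma rsum_diff f a b : (forall i, 0 <= a i) -> (forall i, 0 <= b i) ->
  asum a -> asum b -> (forall i, f i = a i - b i) -> rsum f = nsum a - nsum b.
Proof.
move=> a0 b0 sa sb fE; have sf : asum f.
  apply: (@asum_le _ (a \+ b)); last exact: asumD.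
  move=> i; rewrite fE; apply: le_trans (ler_normB _ _) _.
  by rewrite !ger0_norm.
have E : nsum (fun i => `|f i| + f i) + nsum b = nsum (fun i => `|f i|) + nsum a.
  rewrite -(nsumD _ _ (posp_asum sf) sb)// -(nsumD _ _ (asum_norm sf) sa)//.
  by congr nsum; apply/funext => i /=; rewrite fE; ring.
by rewrite /rsum; lra.
Qed.

Lemma rsum_ge0E f : (forall i, 0 <= f i) -> asum f -> rsum f = nsum f.
Proof.
move=> f0 sf; rewrite /rsum ge0_normE//.
rewrite (_ : (fun i => _) = f \+ f)//; last by apply/funext => i; rewrite ger0_norm.
by rewrite (nsumD f0 f0 sf sf) addrK.
Qed.

Lemma rsumD f g : asum f -> asum g -> rsum (f \+ g) = rsum f + rsum g.
Proof.
move=> sf sg.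
rewrite (@rsum_diff _ ((fun i => `|f i| + f i) \+ (fun i => `|g i| + g i))
  ((fun i => `|f i|) \+ (fun i => `|g i|))).
- rewrite (nsumD _ _ (posp_asum sf) (posp_asum sg))//.
  by rewrite (nsumD _ _ (asum_norm sf) (asum_norm sg))// /rsum; ring.
- by move=> i /=; rewrite addr_ge0.
- by move=> i /=; rewrite addr_ge0.
- by apply: asumD; exact: posp_asum.
- by apply: asumD; exact: asum_norm.
- by move=> i /=; ring.
Qed.

Lemma rsumZ (c : R) f : asum f -> rsum (fun i => c * f i) = c * rsum f.
Proof.
move=> sf; have sp := posp_asum sf; have sn := asum_norm sf.
have [c0|c0] := leP 0 c.
  rewrite (@rsum_diff _ (fun i => c * (`|f i| + f i)) (fun i => c * `|f i|)).
  - by rewrite !nsumZ// /rsum mulrBr.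
  - by move=> i; rewrite mulr_ge0.
  - by move=> i; rewrite mulr_ge0.
  - exact: asumZ.
  - exact: asumZ.
  - by move=> i /=; ring.
rewrite (@rsum_diff _ (fun i => (- c) * `|f i|) (fun i => (- c) * (`|f i| + f i))).
- by rewrite !nsumZ// ?oppr_ge0 ?(ltW c0)// /rsum; ring.
- by move=> i; rewrite mulr_ge0// oppr_ge0 ltW.
- by move=> i; rewrite mulr_ge0// oppr_ge0 ltW.
- exact: asumZ.
- exact: asumZ.
- by move=> i /=; ring.
Qed.

End UnorderedSums.

(** Reindexing along an injection whose range contains the support. *)
Lemma nsum_reindex (R : realType) (I J : choiceType) (e : J -> I) (f : I -> R) :
  injective e -> (forall i, ~ range e i -> f i = 0) -> nsum f = nsum (f \o e).
Proof.
move=> ei f0; rewrite /nsum; congr fine.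
rewrite /esumR -(esum_image [set: J] e (fun i => (f i)%:E)); last first.
  by move=> x y _ _; exact: ei.
rewrite [RHS]esum_mkcond; apply: eq_esum => i _.
by case: ifPn => // /negP; rewrite inE => /f0 ->.
Qed.

Lemma rsum_reindex (R : realType) (I J : choiceType) (e : J -> I) (f : I -> R) :
  injective e -> (forall i, ~ range e i -> f i = 0) -> rsum f = rsum (f \o e).
Proof.
move=> ei f0; rewrite /rsum.
rewrite (nsum_reindex (f := fun i => `|f i| + f i) ei); last first.
  by move=> i /f0 ->; rewrite normr0 addr0.
rewrite (nsum_reindex (f := fun i => `|f i|) ei)//.
by move=> i /f0 ->; rewrite normr0.
Qed.

(** * The Hilbert space of square-summable families *)

Section SquareSummable.
Variables (R : realType) (I : choiceType).
Implicit Types x y : I -> R[i]^o.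

(** The real part of z times the conjugate of w. *)
Definition dot (z w : R[i]) : R :=
  complex.Re z * complex.Re w + complex.Im z * complex.Im w.

Lemma sqnE (z : R[i]) : sqn z = dot z z.
Proof. by rewrite /sqn /dot !expr2. Qed.

Lemma sqnM (z w : R[i]) : sqn (z * w) = sqn z * sqn w.
Proof. by case: z => a b; case: w => c d; rewrite /sqn /=; ring. Qed.

Lemma sqnD_le (z w : R[i]) : sqn (z + w) <= 2 * (sqn z + sqn w).
Proof. by case: z => a b; case: w => c d; rewrite /sqn /=;
  have := sqr_ge0 (a - c); have := sqr_ge0 (b - d); nra. Qed.

Lemma dot_le (z w : R[i]) : `|dot z w| <= sqn z + sqn w.
Proof.
by case: z => a b; case: w => c d; rewrite /sqn /dot /= ler_norml;
  have := (sqr_ge0 (a - c), sqr_ge0 (b - d), sqr_ge0 (a + c), sqr_ge0 (b + d));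
  move=> [[[? ?] ?] ?]; apply/andP; split; nra.
Qed.

Definition square_summable : {pred I -> R[i]^o} :=
  fun x => asum (fun i => sqn (x i)).

Fact square_summable_submod : submod_closed square_summable.
Proof.
split=> [|a x y xs ys].
  rewrite unfold_in /= /asum /esumR esum1// => i _.
  by rewrite /sqn /= expr0n addr0 normr0.
apply: (@asum_le _ _ _ (fun i => 2 * (sqn a * sqn (x i) + sqn (y i)))).
  by move=> i; rewrite ger0_norm ?sqn_ge0// -sqnM; exact: sqnD_le.
by apply: asumZ; apply: asumD => //; exact: asumZ.
Qed.
HB.instance Definition _ :=
  GRing.isSubmodClosed.Build _ _ square_summable square_summable_submod.

Record l2 := L2 { l2_val :> I -> R[i]^o; l2P : l2_val \in square_summable }.
HB.instance Definition _ := [isSub for l2_val].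
HB.instance Definition _ := [Choice of l2 by <:].
HB.instance Definition _ := [SubChoice_isSubLmodule of l2 by <:].
End SquareSummable.

Section SquareSummableHilbert.
Variables (R : realType) (I : choiceType).
Notation l2 := (l2 R I).
Implicit Types x y z : l2.

Lemma l2D x y i : (x + y) i = x i + y i. Proof. by []. Qed.
Lemma l2Z (a : R[i]) x i : (a *: x) i = a * x i. Proof. by []. Qed.
Lemma l20 i : (0 : l2) i = 0. Proof. by []. Qed.

Lemma l2_ext x y : (forall i, x i = y i) -> x = y.
Proof. by move=> xy; apply: val_inj; apply/funext. Qed.

Lemma asum_sqn x : asum (fun i => sqn (x i)).
Proof. exact: l2P. Qed.

Lemma asum_dot x y : asum (fun i => dot (x i) (y i)).
Proof.
apply: (@asum_le _ _ _ ((fun i => sqn (x i)) \+ (fun i => sqn (y i)))).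
  by move=> i; exact: dot_le.
by apply: asumD; exact: asum_sqn.
Qed.

Definition l2_ip x y : R := rsum (fun i => dot (x i) (y i)).

Lemma l2_ipE x : l2_ip x x = nsum (fun i => sqn (x i)).
Proof.
rewrite /l2_ip rsum_ge0E; last exact: asum_dot.
  by congr nsum; apply/funext => i; rewrite sqnE.
by move=> i; rewrite -sqnE sqn_ge0.
Qed.

Fact l2_ipC x y : l2_ip x y = l2_ip y x.
Proof. by congr rsum; apply/funext => i; rewrite /dot; ring. Qed.

Fact l2_ipDl x y z : l2_ip (x + y) z = l2_ip x z + l2_ip y z.
Proof.
rewrite -(rsumD (asum_dot x z) (asum_dot y z)).
by congr rsum; apply/funext => i; rewrite /dot l2D !raddfD /=; ring.
Qed.

Fact l2_ipZl (a : R) x y : l2_ip (a%:C *: x) y = a * l2_ip x y.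
Proof.
rewrite -(rsumZ a (asum_dot x y)).
congr rsum; apply/funext => i; rewrite /dot l2Z.
by case: (x i) => b c; case: (y i) => d e /=; ring.
Qed.

Fact l2_ipJ (a : R[i]) x y : l2_ip (a *: x) y = l2_ip x (a^* *: y).
Proof.
congr rsum; apply/funext => i; rewrite /dot !l2Z.
by case: a => p q; case: (x i) => b c; case: (y i) => d e /=; ring.
Qed.

Fact l2_ip_ge0 x : 0 <= l2_ip x x.
Proof. by rewrite l2_ipE nsum_ge0// => i; exact: sqn_ge0. Qed.

Lemma sqn_le_ip x i : sqn (x i) <= l2_ip x x.
Proof.
rewrite l2_ipE; apply: (@le_nsum _ _ (fun i => sqn (x i))) => [j|].
  exact: sqn_ge0.
exact: asum_sqn.
Qed.

Lemma sqn_eq0 (z : R[i]) : sqn z <= 0 -> z = 0.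
Proof.
case: z => a b; rewrite /sqn /= => h; apply/eqP.
rewrite eq_complex /= -(sqrf_eq0 a) -(sqrf_eq0 b).
by have := (sqr_ge0 a, sqr_ge0 b) => -[? ?]; apply/andP; split; apply/eqP; lra.
Qed.

Fact l2_ip_eq0 x : l2_ip x x = 0 -> x = 0.
Proof.
by move=> x0; apply: l2_ext => i; apply: sqn_eq0; rewrite -x0 sqn_le_ip.
Qed.

Lemma real_cauchy_cvg (u : nat -> R) :
  (forall e : R, 0 < e -> exists N, forall m n, (N <= m)%N -> (N <= n)%N ->
     `|u m - u n| < e) ->
  exists l : R, u n @[n --> \oo] --> l.
Proof.
move=> uC.
suff h : cvgn u by exists (limn u).
apply: cauchy_cvg; apply: cauchy_exP => e e0.
have [N uN] := uC _ e0; exists (u N); exists N => // n /= Nn.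
by apply: uN.
Qed.

Lemma sqn_lt_abs (z : R[i]) (e : R) : 0 < e -> Num.sqrt (sqn z) < e ->
  `|complex.Re z| < e /\ `|complex.Im z| < e.
Proof.
case: z => a b e0 h; split; apply: le_lt_trans h; rewrite -sqrtr_sqr;
  by rewrite ler_sqrt ?sqn_ge0// /sqn /= ?lerDl ?lerDr sqr_ge0.
Qed.

(** The limit is taken coordinatewise; a Cauchy estimate on finite partial sums
passes to the limit and bounds the distance to it. *)
Fact l2_complete (u : nat -> l2) :
  (forall e : R, 0 < e -> exists N, forall m n, (N <= m)%N -> (N <= n)%N ->
     Num.sqrt (l2_ip (u m - u n) (u m - u n)) < e) ->
  exists l, Num.sqrt (l2_ip (u n - l) (u n - l)) @[n --> \oo] --> (0 : R).
Proof.
move=> uC.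
have coordC (e : R) i : 0 < e -> exists N, forall m n, (N <= m)%N ->
    (N <= n)%N -> `|complex.Re (u m i) - complex.Re (u n i)| < e /\
                  `|complex.Im (u m i) - complex.Im (u n i)| < e.
  move=> e0; have [N uN] := uC _ e0; exists N => m n Nm Nn.
  rewrite -!raddfB; apply: sqn_lt_abs => //.
  apply: le_lt_trans (uN _ _ Nm Nn).
  by rewrite ler_wsqrtr// (sqn_le_ip (u m - u n)).
have /choice[a aP] : forall i, exists a : R,
    complex.Re (u n i) @[n --> \oo] --> a.
  move=> i; apply: real_cauchy_cvg => e /(coordC _ i)[N uN].
  by exists N => m n Nm Nn; case: (uN _ _ Nm Nn).
have /choice[b bP] : forall i, exists b : R,
    complex.Im (u n i) @[n --> \oo] --> b.
  move=> i; apply: real_cauchy_cvg => e /(coordC _ i)[N uN].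
  by exists N => m n Nm Nn; case: (uN _ _ Nm Nn).
pose l i : R[i]^o := Complex (a i) (b i).
have tail (e : R) : 0 < e -> exists N, forall n, (N <= n)%N ->
    (esumR (fun i => sqn (u n i - l i)%R) <= (e ^+ 2)%:E)%E.
  move=> e0; have [N uN] := uC _ e0; exists N => n Nn.
  apply: esumR_finite => s us.
  have cvg_s : \sum_(i <- s) sqn (u n i - u m i) @[m --> \oo] -->
      \sum_(i <- s) sqn (u n i - l i).
    elim: s {us} => [|i s IHs].
      by rewrite big_nil; under eq_fun do rewrite big_nil; exact: cvg_cst.
    rewrite big_cons; under eq_fun do rewrite big_cons.
    apply: cvgD => //; rewrite /sqn !expr2 !raddfB /=.
    under eq_fun do rewrite !raddfB /=.
    by apply: cvgD; apply: cvgM; apply: cvgB => //; exact: cvg_cst.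
  apply: (ler_cvg_to cvg_s (cvg_cst _)); exists N => // m /= Nm.
  rewrite -lee_fin (le_trans (esumR_sum _ us))//.
    by move=> i; exact: sqn_ge0.
  rewrite -[esumR _](nsumEFin _ (asum_sqn (u n - u m))); last first.
    by move=> i; exact: sqn_ge0.
  rewrite lee_fin -l2_ipE -[l2_ip _ _]sqr_sqrtr ?l2_ip_ge0//.
  by rewrite ler_pXn2r ?nnegrE ?sqrtr_ge0 ?(ltW e0)// ltW// uN.
have l_l2 : l \in @square_summable R I.
  have [N uN] := tail _ (@ltr01 R).
  rewrite (_ : l = l2_val (u N) - (l2_val (u N) - l)); last by rewrite subKr.
  apply: rpredB; first exact: l2P.
  rewrite unfold_in /= /asum ge0_normE => [|i]; last exact: sqn_ge0.
  exact: le_lt_trans (uN N (leqnn N)) (ltry _).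
exists (L2 l_l2); apply/cvgrPdist_le => e e0.
have [N uN] := tail _ e0; exists N => // n /= Nn.
rewrite sub0r normrN ger0_norm ?sqrtr_ge0//.
rewrite -(@ler_pXn2r _ 2)// ?nnegrE ?sqrtr_ge0 ?(ltW e0)// sqr_sqrtr ?l2_ip_ge0//.
rewrite l2_ipE -lee_fin nsumEFin => [|i|]; first exact: uN.
  exact: sqn_ge0.
exact: asum_sqn.
Qed.

Fact l2_basis_subproof (i : I) :
  (fun j => (j == i)%:R : R[i]^o) \in @square_summable R I.
Proof.
rewrite unfold_in /= /asum; apply: (@le_lt_trans _ _ (1%:E)%E) (ltry _).
apply: esumR_finite => s us.
have [si|si] := boolP (i \in s).
  rewrite (bigD1_seq i)//= big1 => [|j /negPf ji]; rewrite ?eqxx ?ji /sqn /=.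
    by rewrite expr1n expr0n !addr0 normr1.
  by rewrite expr0n addr0 normr0.
rewrite big1_seq => [|j /andP[_ js]]; first exact: ler01.
have /negPf -> : j != i by apply: contra si => /eqP <-.
by rewrite /sqn /= expr0n addr0 normr0.
Qed.
Definition l2_basis (i : I) : l2 := L2 (l2_basis_subproof i).

Fact l2_nontrivial (i : I) : exists x : l2, x != 0.
Proof.
exists (l2_basis i); apply/eqP => /(congr1 (fun x : l2 => x i)).
by rewrite l20 /= eqxx => /eqP; rewrite oner_eq0.
Qed.

Definition l2_hilbert (i : I) : hilbert R :=
  Hilbert l2_ipC l2_ipDl l2_ipZl l2_ipJ l2_ip_ge0 l2_ip_eq0 l2_complete
    (l2_nontrivial i).

End SquareSummableHilbert.

(** * C*-algebras: commutants, square roots, contractivity *)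

Section CStarTheory.
Variables (R : realType) (A : cstarAlgType R).
Implicit Types x y d : A.
Notation normc := ComplexField.Normc.normc.

Lemma normc_real (r : R) : normc r%:C = `|r|.
Proof. by rewrite normcE_sqn /sqn /= expr0n addr0 sqrtr_sqr. Qed.

Lemma cnorm0 : cnorm (0 : A) = 0.
Proof. by rewrite -(scale0r (0 : A)) cnormZ ComplexField.Normc.normc0 mul0r. Qed.

Lemma cnormZr (r : R) x : cnorm (r%:C *: x) = `|r| * cnorm x.
Proof. by rewrite cnormZ normc_real. Qed.

Lemma cnormN x : cnorm (- x) = cnorm x.
Proof.
have -> : - x = (-1 : R)%:C *: x by rewrite rmorphN rmorph1 scaleN1r.
by rewrite cnormZr normrN1 mul1r.
Qed.

Lemma cnormB x y : cnorm (x - y) = cnorm (y - x).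
Proof. by rewrite -cnormN opprB. Qed.

Lemma cnorm_ge0 x : 0 <= cnorm x.
Proof.
by have := cnormD x (- x); rewrite subrr cnorm0 cnormN; lra.
Qed.

Lemma star0 : star (0 : A) = 0.
Proof.
have -> : star (0 : A) = star ((0 : R[i]) *: (0 : A)) by rewrite scaler0.
by rewrite starZ conjc0 scale0r.
Qed.

Lemma starN x : star (- x) = - star x.
Proof. by apply/eqP; rewrite -addr_eq0 -starD addNr star0. Qed.

Lemma starB x y : star (x - y) = star x - star y.
Proof. by rewrite starD starN. Qed.

Lemma star1 : star (1 : A) = 1.
Proof.
by have := starM (star (1 : A)) 1; rewrite mulr1 starK mulr1 => <-.
Qed.

Let cnorm_star_ge x : cnorm x <= cnorm (star x).
Proof.
have [->|x0] := eqVneq (cnorm x) 0; first exact: cnorm_ge0.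
have xp : 0 < cnorm x by rewrite lt_def x0 cnorm_ge0.
by rewrite -(ler_pM2r xp) -expr2 -cnorm_star cnormM.
Qed.

Lemma cnorm_starE x : cnorm (star x) = cnorm x.
Proof.
apply/eqP; rewrite eq_le cnorm_star_ge andbT.
by rewrite -{2}[x]starK cnorm_star_ge.
Qed.

Definition cnorm_cvg (u : nat -> A) l := cnorm (u n - l) @[n --> \oo] --> (0 : R).

(** The form in which identities are passed to norm limits below. *)
Lemma cnorm_le_cvg0 x (v : nat -> R) : (forall n, cnorm x <= v n) ->
  v n @[n --> \oo] --> (0 : R) -> x = 0.
Proof.
move=> xv v0; apply: cnorm_eq0; apply/eqP; rewrite eq_le cnorm_ge0 andbT.
by apply: (ler_cvg_to (cvg_cst (cnorm x)) v0); apply: nearW.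
Qed.

Lemma commutant_cstar d : star d = d ->
  cstar_subalgebra [set x : A | x * d = d * x].
Proof.
move=> dd; split => /=.
- by rewrite mul0r mulr0.
- by move=> x y xd yd; rewrite mulrDl mulrDr xd yd.
- by move=> a x xd; rewrite -scalerAl -scalerAr xd.
- by move=> x y xd yd; rewrite -mulrA yd mulrA xd mulrA.
- by move=> x xd; rewrite -{1}dd -starM -xd starM dd.
- move=> u l ud ul /=; apply/eqP; rewrite -subr_eq0; apply/eqP.
  apply: (@cnorm_le_cvg0 _ (fun n => cnorm (u n - l) * (cnorm d + cnorm d))).
    move=> n.
    have -> : l * d - d * l = - ((u n - l) * d - d * (u n - l)).
      by rewrite mulrBl mulrBr ud opprB (opprB (d * u n)) [RHS]addrC addrA subrK.
    rewrite cnormN (le_trans (cnormD _ _))// cnormN [leRHS]mulrDr lerD//.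
      exact: cnormM.
    by rewrite mulrC cnormM.
  by rewrite -(mul0r (cnorm d + cnorm d)); apply: cvgMl.
Qed.

End CStarTheory.

Lemma preimage_cstar (R : realType) (A B : cstarAlgType R)
    (f : {lrmorphism A -> B})
    (D : set B) : (forall x, f (star x) = star (f x)) ->
  (forall x, cnorm (f x) <= cnorm x) ->
  cstar_subalgebra D -> cstar_subalgebra (f @^-1` D).
Proof.
move=> fstar fle [D0 DD DZ DM Dstar Dcl]; split => /=.
- by rewrite raddf0.
- by move=> x y Dx Dy; rewrite raddfD; exact: DD.
- by move=> a x Dx; rewrite linearZ; exact: DZ.
- by move=> x y Dx Dy; rewrite rmorphM; exact: DM.
- by move=> x Dx; rewrite fstar; exact: Dstar.
- move=> u l Du ul; apply: (Dcl (f \o u)) => //.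
  apply: (@squeeze0 _ _ (fun n => cnorm (u n - l))) => //= n.
  by rewrite -raddfB fle cnorm_ge0.
Qed.


(** The square root of 1 - a for self-adjoint a of norm < 1.  If z is a fixed
point of z -> (a + z^2)/2 then (1 - z)^2 = 1 - a.  On the ball of radius
c = 1 - sqrt(1 - |a|) < 1 that map is a c-contraction into the ball, since
(|a| + c^2)/2 = c and x^2 - y^2 = x (x - y) + (x - y) y, which holds without
commutativity. *)
Section SquareRoot.
Variables (R : realType) (A : cstarAlgType R) (a : A).
Hypotheses (a_lt1 : cnorm a < 1) (a_star : star a = a).

Let c : R := 1 - Num.sqrt (1 - cnorm a).

Let sqrt_ge0 : 0 <= Num.sqrt (1 - cnorm a). Proof. exact: sqrtr_ge0. Qed.
Let sqrt_sqr : Num.sqrt (1 - cnorm a) ^+ 2 = 1 - cnorm a.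
Proof. by rewrite sqr_sqrtr// subr_ge0 ltW. Qed.

Let c_ge0 : 0 <= c.
Proof.
rewrite subr_ge0 -[leRHS]sqrtr1 ler_wsqrtr// lerBlDr lerDl; exact: cnorm_ge0.
Qed.

Let c_lt1 : c < 1.
Proof. by rewrite /c ltrBlDr ltrDl sqrtr_gt0 subr_gt0. Qed.

Let c_fix : 2^-1 * (cnorm a + c * c) = c.
Proof. by rewrite /c; move: sqrt_sqr; rewrite expr2; lra. Qed.

Let step (z : A) : A := (2^-1 : R)%:C *: (a + z * z).
Let iterates n : A := iter n step 0.

Let half_norm (x : A) : cnorm ((2^-1 : R)%:C *: x) = 2^-1 * cnorm x.
Proof. by rewrite cnormZr ger0_norm. Qed.

Let iterates_le n : cnorm (iterates n) <= c.
Proof.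
elim: n => [|n IHn]; first by rewrite cnorm0.
rewrite /= half_norm -[leRHS]c_fix ler_wpM2l ?invr_ge0//.
rewrite (le_trans (cnormD _ _))// lerD2l (le_trans (cnormM _ _))//.
by rewrite ler_pM ?cnorm_ge0.
Qed.

Let step_contract x y : cnorm x <= c -> cnorm y <= c ->
  cnorm (step x - step y) <= c * cnorm (x - y).
Proof.
move=> xc yc; rewrite -scalerBr half_norm.
have -> : a + x * x - (a + y * y) = x * (x - y) + (x - y) * y.
  by rewrite mulrBr mulrBl opprD addrACA subrr add0r addrA subrK.
have hx : cnorm (x * (x - y)) <= c * cnorm (x - y).
  by rewrite (le_trans (cnormM _ _))// ler_wpM2r ?cnorm_ge0.
have hy : cnorm ((x - y) * y) <= c * cnorm (x - y).
  by rewrite (le_trans (cnormM _ _))// mulrC ler_wpM2r ?cnorm_ge0.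
have := cnormD (x * (x - y)) ((x - y) * y); lra.
Qed.

Let iterates_cauchy n k : cnorm (iterates (n + k) - iterates n) <= c ^+ n.
Proof.
elim: n => [|n IHn].
  by rewrite subr0 expr0 (le_trans (iterates_le _))// ltW.
rewrite addSn /= (le_trans (step_contract _ _))//.
by rewrite exprS ler_wpM2l.
Qed.

Let iterates_star n : star (iterates n) = iterates n.
Proof.
elim: n => [|n IHn]; first exact: star0.
by rewrite /= starZ conjc_real starD a_star starM IHn.
Qed.

Lemma cstar_sqrt : exists2 y : A, star y = y & y * y = 1 - a.
Proof.
have c_exp : c ^+ n @[n --> \oo] --> (0 : R).
  by apply: cvg_expr; rewrite ger0_norm.
have [l il] : exists l, cnorm_cvg iterates l.
  apply: cnorm_complete => e e0.
  have e20 : 0 < e / 2 by rewrite divr_gt0.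
  have /cvgrPdist_lt/(_ _ e20)[N _ hN] := c_exp.
  have near_N n : (N <= n)%N -> cnorm (iterates n - iterates N) < e / 2.
    move=> /subnKC <-; apply: le_lt_trans (iterates_cauchy _ _) _.
    by have := hN N (leqnn N); rewrite /= sub0r normrN;
      apply: le_lt_trans (ler_norm _).
  exists N => m n /near_N hm /near_N hn.
  have := cnormD (iterates m - iterates N) (iterates N - iterates n).
  by rewrite addrA subrK [cnorm (iterates N - _)]cnormB; lra.
have l_star : star l = l.
  apply/eqP; rewrite -subr_eq0; apply/eqP.
  apply: (@cnorm_le_cvg0 _ _ _
      (fun n => cnorm (iterates n - l) + cnorm (iterates n - l))) => [n|].
    have := cnormD (star l - iterates n) (iterates n - l).
    have e : star l - iterates n = star (l - iterates n).
      by rewrite starB iterates_star.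
    by rewrite addrA subrK e cnorm_starE [cnorm (l - _)]cnormB.
  by rewrite -[0 : R]addr0; exact: cvgD.
have l_le : cnorm l <= c.
  apply/ler_addgt0Pl => e e0.
  have /cvgrPdist_lt/(_ _ e0)[N _ hN] := il.
  have := hN N (leqnn N); rewrite /= sub0r normrN ger0_norm ?cnorm_ge0// => h.
  have := cnormD (l - iterates N) (iterates N).
  by rewrite subrK cnormB; have := iterates_le N; lra.
have l_fix : step l = l.
  apply/eqP; rewrite -subr_eq0; apply/eqP.
  apply: (@cnorm_le_cvg0 _ _ _
      (fun n => cnorm (iterates n - l) + cnorm (iterates n.+1 - l))) => [n|].
    have h1 := cnormD (step l - step (iterates n)) (step (iterates n) - l).
    rewrite addrA subrK in h1; apply: (le_trans h1); rewrite lerD2r.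
    apply: le_trans (step_contract l_le (iterates_le n)) _.
    by rewrite cnormB ler_piMl ?cnorm_ge0// ltW.
  rewrite -[0 : R]addr0; apply: cvgD => //.
  by move/cvgrPdist_lt: il => il; apply/cvgrPdist_lt => e /il[N _ hN];
    exists N => // n Nn; apply: hN; exact: leqW.
exists (1 - l); first by rewrite starB star1 l_star.
have := congr1 (fun x => (2 : R)%:C *: x) l_fix.
rewrite /= scalerA -rmorphM /= mulfV ?pnatr_eq0// rmorph1 scale1r => e.
rewrite mulrBl mul1r mulrBr mulr1.
have -> : 1 - l - (l - l * l) = 1 - ((2 : R)%:C *: l - l * l).
  rewrite rmorph_nat scaler_nat mulr2n -[X in _ = 1 - X]addrA.
  by rewrite (opprD l (l - l * l)) addrA.
by rewrite -e addrK.
Qed.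

End SquareRoot.

Section Contractive.
Variables (R : realType) (A : cstarAlgType R) (H : hilbert R).
Variable f : {lrmorphism A -> bop H}.
Hypothesis f_star : forall x, f (star x) = star (f x).

Let unit_ball x : cnorm x < 1 -> cnorm (f x) <= 1.
Proof.
move=> x1; have a1 : cnorm (star x * x) < 1.
  by rewrite cnorm_star expr_lt1// cnorm_ge0.
have as_ : star (star x * x) = star x * x by rewrite starM starK.
have [y ys yE] := cstar_sqrt a1 as_.
apply: opnorm_le => // xi; rewrite mul1r -(@ler_pXn2r _ 2)// ?nnegrE ?hnorm_ge0//.
rewrite !sqr_hnorm bop_ip -[bop_adj (f x) _]/((star (f x) * f x) xi).
rewrite -f_star -rmorphM (_ : star x * x = 1 - y * y); last by rewrite yE subKr.
have fy : star (f y) = f y by rewrite -f_star ys.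
have fyE : ip xi ((f y * f y) xi) = ip (f y xi) (f y xi).
  by rewrite bop_ip -[bop_adj (f y) _]/((star (f y) * f y) xi) fy.
by rewrite rmorphB rmorph1 rmorphM ipBr lerBlDr lerDl fyE ip_ge0.
Qed.

(** For |x| < 1, the image of 1 - x*x = y*y evaluated at a vector xi gives
|xi|^2 - |f(x) xi|^2 = |f(y) xi|^2 >= 0. *)
Lemma star_hom_contractive x : cnorm (f x) <= cnorm x.
Proof.
apply/ler_addgt0Pl => e e0; set t := e + cnorm x.
have t0 : 0 < t by rewrite ltr_pwDl ?cnorm_ge0.
have xE : x = t%:C *: ((t^-1)%:C *: x).
  by rewrite scalerA -rmorphM /= mulfV ?gt_eqF// rmorph1 scale1r.
rewrite {1}xE linearZ /= cnormZr gtr0_norm//.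
rewrite -[leRHS]mulr1 ler_pM2l//; apply: unit_ball.
by rewrite cnormZr gtr0_norm ?invr_gt0// mulrC ltr_pdivrMr// mul1r ltrDr.
Qed.

End Contractive.

(** * Completely continuous operators *)

Section CompletelyContinuous.
Variables (R : realType) (H : hilbert R).
Implicit Types (S T : bop H) (x : nat -> H).

Definition bounded_seq x := exists M, forall n, hnorm (x n) <= M.

Definition weakly_null x := forall y, ip (x n) y @[n --> \oo] --> (0 : R).

(** On a Hilbert space this is compactness of T.  The sequential form makes
stability under products immediate, because bounded operators preserve bounded
weakly null sequences. *)
Definition completely_continuous T := forall x,
  bounded_seq x -> weakly_null x -> hnorm (T (x n)) @[n --> \oo] --> (0 : R).

Lemma bounded_seq_op T x : bounded_seq x -> bounded_seq (T \o x).
Proof.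
move=> [M xM]; have [L L0 TL] := bop_bounded_ge0 T; exists (L * M) => n /=.
by rewrite (le_trans (TL _))// ler_wpM2l.
Qed.

Lemma weakly_null_op T x : weakly_null x -> weakly_null (T \o x).
Proof. by move=> x0 y /=; under eq_fun do rewrite bop_ip; exact: x0. Qed.

Lemma completely_continuous0 : completely_continuous 0.
Proof.
by move=> x _ _; under eq_fun do rewrite /= hnorm0; exact: cvg_cst.
Qed.

Lemma completely_continuousD S T :
  completely_continuous S -> completely_continuous T ->
  completely_continuous (S + T).
Proof.
move=> cS cT x xb x0.
apply: (@squeeze0 _ _ (fun n => hnorm (S (x n)) + hnorm (T (x n)))) => [n|].
  by rewrite hnorm_ge0 hnormD.
by rewrite -[0 : R]addr0; apply: cvgD; [exact: cS | exact: cT].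
Qed.

Lemma completely_continuousMl S T :
  completely_continuous T -> completely_continuous (S * T).
Proof.
move=> cT x xb x0.
apply: (@squeeze0 _ _ (fun n => opnorm S * hnorm (T (x n)))) => [n|].
  by rewrite hnorm_ge0 (opnormP S (T (x n))).
by rewrite -(mulr0 (opnorm S)); apply: cvgMr; exact: cT.
Qed.

Lemma completely_continuousMr S T :
  completely_continuous S -> completely_continuous (S * T).
Proof.
by move=> cS x xb x0; apply: (cS (T \o x));
  [exact: bounded_seq_op | exact: weakly_null_op].
Qed.

Lemma completely_continuousZ (a : R[i]) T :
  completely_continuous T -> completely_continuous (a *: T).
Proof.
by move=> cT; rewrite -[T]mul1r scalerAl; exact: completely_continuousMl.
Qed.

(** From |T* x|^2 = <T T* x, x> <= |T T* x| |x|. *)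
Lemma completely_continuous_star T :
  completely_continuous T -> completely_continuous (star T).
Proof.
move=> cT x xb x0; have [M xM] := xb.
apply: cvg0_sqr.
apply: (@squeeze0 _ _ (fun n => hnorm ((T * star T) (x n)) * M)) => [n|].
  rewrite sqr_ge0 sqr_hnorm -bop_ipr ipC (le_trans (cauchy_schwarz _ _))//.
  by rewrite ler_wpM2l ?hnorm_ge0.
by rewrite -(mul0r M); apply: cvgMl; exact: completely_continuousMr.
Qed.

Lemma completely_continuous_closed (u : nat -> bop H) T :
  (forall n, completely_continuous (u n)) -> cnorm_cvg u T ->
  completely_continuous T.
Proof.
move=> uc uT x xb x0; have [M xM] := xb.
have M0 : 0 <= M := le_trans (hnorm_ge0 _) (xM 0%N).
have M1 : 0 < M + 1 by rewrite ltr_wpDl.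
apply/cvgrPdist_lt => e e0.
have d0 : 0 < e / 2 / (M + 1) by rewrite !divr_gt0.
have /cvgrPdist_lt/(_ _ d0)[K _ hK] := uT.
have e20 : 0 < e / 2 by rewrite divr_gt0.
have /cvgrPdist_lt/(_ _ e20)[N _ hN] := uc K _ xb x0.
exists N => // n /hN /=; rewrite !sub0r !normrN !ger0_norm ?hnorm_ge0// => hn.
have := hK K (leqnn K); rewrite /= sub0r normrN ger0_norm ?cnorm_ge0// => hT.
have dist : hnorm ((u K - T) (x n)) <= e / 2 / (M + 1) * (M + 1).
  apply: le_trans (opnormP _ _) _; apply: ler_pM.
  - exact: opnorm_ge0.
  - exact: hnorm_ge0.
  - exact: ltW.
  - by rewrite (le_trans (xM n))// lerDl.
rewrite divfK ?gt_eqF// in dist.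
have := hnormD (u K (x n)) (- (u K - T) (x n)).
by rewrite hnormN /= opprB addrC subrK; lra.
Qed.

(** T -> T d - d T is a derivation, and the completely continuous operators form
a norm-closed two-sided ideal stable under adjoints. *)
Lemma essential_commutant_cstar (d : bop H) : star d = d ->
  cstar_subalgebra [set T : bop H | completely_continuous (T * d - d * T)].
Proof.
move=> dd; split => /=.
- by rewrite mul0r mulr0 subr0; exact: completely_continuous0.
- move=> S T cS cT; rewrite mulrDl mulrDr opprD addrACA.
  exact: completely_continuousD.
- by move=> a T cT; rewrite -scalerAl -scalerAr -scalerBr;
    exact: completely_continuousZ.
- move=> S T cS cT.
  have -> : S * T * d - d * (S * T) = S * (T * d - d * T) + (S * d - d * S) * T.
    by rewrite mulrBr mulrBl !mulrA addrA subrK.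
  by apply: completely_continuousD; 
    [exact: completely_continuousMl | exact: completely_continuousMr].
- move=> T cT.
  have -> : star T * d - d * star T = (-1) * star (T * d - d * T).
    by rewrite starB !starM dd mulN1r opprB.
  by apply: completely_continuousMl; exact: completely_continuous_star.
- move=> u T uc uT; apply: completely_continuous_closed uc _.
  apply: (@squeeze0 _ _ (fun n => cnorm (u n - T) * (cnorm d + cnorm d))) => [n|].
    rewrite cnorm_ge0 /=.
    have -> : u n * d - d * u n - (T * d - d * T) = (u n - T) * d - d * (u n - T).
      by rewrite mulrBl mulrBr !opprD addrACA.
    rewrite (le_trans (cnormD _ _))// cnormN [leRHS]mulrDr lerD ?cnormM//.
    by rewrite mulrC cnormM.
  by rewrite -(mul0r (cnorm d + cnorm d)); apply: cvgMl.
Qed.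

End CompletelyContinuous.

(** * Partial isometries permuting a basis *)

(** A partial bijection of I, given with its inverse.  It induces the partial
isometry of l^2(I) sending the basis vector of i to that of [pfun i], or to 0
where [pfun] is undefined; shift, doubling and the projection onto a set of
coordinates are all of this kind, and the adjoint comes from the inverse. *)
Record pbij (I : Type) := Pbij {
  pfun : I -> option I;
  pinv : I -> option I;
  pbijP : forall i j, pfun i = Some j <-> pinv j = Some i
}.

Definition pbij_inv (I : Type) (b : pbij I) : pbij I :=
  Pbij (fun i j => iff_sym (pbijP b j i)).

Section PartialIsometry.
Variables (R : realType) (I : choiceType) (i0 : I).
Notation l2 := (l2 R I).
Notation H := (l2_hilbert R i0).
Implicit Types (b : pbij I) (x y : l2).

Lemma hnorm_l2 x : hnorm (x : H) ^+ 2 = nsum (fun i => sqn (x i)).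
Proof. by rewrite sqr_hnorm -l2_ipE. Qed.

Let pull_sum b x (s : seq I) : uniq s ->
  \sum_(i <- s) sqn (oapp x 0 (pfun b i)) <= nsum (fun i => sqn (x i)).
Proof.
move=> us.
have -> : \sum_(i <- s) sqn (oapp x 0 (pfun b i)) =
    \sum_(j <- pmap (pfun b) s) sqn (x j).
  elim: s {us} => [|i s IHs]; first by rewrite !big_nil.
  rewrite big_cons IHs /=; case: (pfun b i) => [j|] /=; first by rewrite big_cons.
  by rewrite /sqn /= expr0n !add0r.
rewrite -lee_fin nsumEFin; last exact: asum_sqn; last first.
  by move=> i; exact: sqn_ge0.
apply: esumR_sum => [i|]; first exact: sqn_ge0.
apply: (pmap_uniq (g := fun j => odflt j (pinv b j))) => // i.
by case e : (pfun b i) => [j|] //=; move/pbijP: e => ->.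
Qed.

Fact pull_subproof b x :
  (fun i => oapp x 0 (pfun b i) : R[i]^o) \in @square_summable R I.
Proof.
rewrite unfold_in /= /asum ge0_normE => [|i]; last exact: sqn_ge0.
apply: le_lt_trans (ltry (nsum (fun i => sqn (x i)))).
by apply: esumR_finite => s us; exact: pull_sum.
Qed.
(** Composition with a partial map: this is the adjoint of the partial isometry
of [b]. *)
Definition pull b x : l2 := L2 (pull_subproof b x).

(** Both sums live on the domain of [b]: one directly, the other through the
bijection from the domain onto the range. *)
Fact pull_ip b x y :
  l2_ip (pull (pbij_inv b) x) y = l2_ip x (pull b y).
Proof.
pose dom := {i : I | pfun b i}.
pose h (u : dom) := odflt (val u) (pfun b (val u)).
have hP (u : dom) : pfun b (val u) = Some (h u).
  by rewrite /h; case: u => i /=; case: (pfun b i).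
have hP' (u : dom) : pinv b (h u) = Some (val u) by apply/pbijP.
rewrite /l2_ip (@rsum_reindex _ _ _ h); first last.
- move=> j nj; rewrite /=; case e : (pinv b j) => [i|]; last first.
    by rewrite /dot /= !mul0r addr0.
  have ei : pfun b i = Some j by apply/pbijP.
  have di : pfun b i by rewrite ei.
  exfalso; apply: nj; exists (exist _ i di) => //.
  by rewrite /h /= ei.
- move=> u v uv; apply: val_inj; apply: Some_inj.
  by rewrite -!hP' uv.
rewrite [RHS](@rsum_reindex _ _ dom val); first last.
- move=> i ni; rewrite /=; case e : (pfun b i) => [j|]; last first.
    by rewrite /dot /= !mulr0 addr0.
  have di : pfun b i by rewrite e.
  by exfalso; apply: ni; exists (exist _ i di).
- exact: val_inj.
by congr rsum; apply/funext => u /=; rewrite hP' hP.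
Qed.

Fact pullZ b (a : R[i]) x : pull b (a *: x) = a *: pull b x.
Proof.
apply: l2_ext => i; rewrite l2Z /=.
by case: (pfun b i) => [j|] //=; rewrite mulr0.
Qed.

Fact pull_bounded b : exists M, forall x : H, hnorm (pull b x : H) <= M * hnorm x.
Proof.
exists 1 => x; rewrite mul1r -(@ler_pXn2r _ 2)// ?nnegrE ?hnorm_ge0// !hnorm_l2.
rewrite -lee_fin nsumEFin => [|i|]; last exact: asum_sqn; last exact: sqn_ge0.
by apply: esumR_finite => s us; exact: pull_sum.
Qed.

Definition pbij_op b : bop H :=
  @Bop R H (pull (pbij_inv b)) (pull b) (pull_ip b) (pullZ (pbij_inv b))
    (pull_bounded (pbij_inv b)).

Lemma pbij_opE b (x : H) j : (pbij_op b x : l2) j = oapp (x : l2) 0 (pinv b j).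
Proof. by []. Qed.

Lemma pbij_op_basis b i :
  pbij_op b (l2_basis R i) = oapp (@l2_basis R I) 0 (pfun b i).
Proof.
apply: l2_ext => j; rewrite pbij_opE.
case e : (pinv b j) => [i'|] /=.
  move/pbijP: e => e; have [ii|ii] := eqVneq i' i.
    by rewrite -ii e /= eqxx.
  case e' : (pfun b i) => [j'|] //=; have [jj|//] := eqVneq j j'.
  move: e e'; rewrite jj => /pbijP e /pbijP; rewrite e => -[] ii'.
  by rewrite ii' eqxx in ii.
case e' : (pfun b i) => [j'|] //=; have [jj|//] := eqVneq j j'.
by move: e; rewrite jj; move/pbijP: e' => ->.
Qed.

End PartialIsometry.

Section Coordinates.
Variables (R : realType) (I : choiceType) (i0 : I).
Notation l2 := (l2 R I).
Notation H := (l2_hilbert R i0).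

Lemma nsum_single (f : I -> R) k : 0 <= f k ->
  (forall i, i != k -> f i = 0) -> nsum f = f k.
Proof.
move=> fk f0; rewrite /nsum (_ : esumR f = (f k)%:E)//.
rewrite -(@esum_set1 _ _ k (fun i => (f i)%:E)) ?lee_fin//.
rewrite [RHS]esum_mkcond; apply: eq_esum => i _.
case: ifPn => // /negP ik; rewrite f0//.
by apply/eqP => ike; apply: ik; rewrite inE.
Qed.

Lemma rsum_single (f : I -> R) k :
  (forall i, i != k -> f i = 0) -> rsum f = f k.
Proof.
move=> f0; rewrite /rsum (nsum_single (k := k)) => [||i ik].
- rewrite (nsum_single (k := k)) => [||i ik]; first by rewrite addrAC subrr add0r.
    exact: normr_ge0.
  by rewrite f0// normr0.
- by have := ler_norm (- f k); rewrite normrN; lra.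
- by rewrite f0// normr0 addr0.
Qed.

Lemma ip_basis (x : l2) (c : R[i]) k : l2_ip x (c *: l2_basis R k) = dot (x k) c.
Proof.
rewrite /l2_ip (rsum_single (k := k)) => [|i /negPf ik].
  by rewrite l2Z /= eqxx mulr1.
by rewrite l2Z /= ik mulr0 /dot /= !mulr0 addr0.
Qed.

Lemma dot_inj (z w : R[i]) : (forall c, dot z c = dot w c) -> z = w.
Proof.
move=> zw; have := zw 1; have := zw (Complex 0 1).
rewrite /dot /= !mulr0 !mulr1 !addr0 !add0r.
by case: z w {zw} => a b [c d] /= -> ->.
Qed.

Lemma hnorm_basis k : hnorm (l2_basis R k : H) = 1.
Proof.
rewrite /hnorm -[X in ip _ X]scale1r -[ip _ _]/(l2_ip _ _) ip_basis /dot /= eqxx.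
by rewrite mulr1 mul0r addr0 sqrtr1.
Qed.

(** Self-adjointness turns the action on basis vectors into the action on
coordinates, so no density argument is needed. *)
Lemma diag_eigen (T : bop H) (a : I -> R) : star T = T ->
  (forall k, T (l2_basis R k) = (a k)%:C *: l2_basis R k) ->
  forall (x : l2) k, (T x : l2) k = (a k)%:C * x k.
Proof.
move=> TT Tb x k; apply: dot_inj => c.
rewrite -ip_basis -[l2_ip _ _]/(ip (T x) (c *: l2_basis R k : H)).
rewrite bop_ip -[bop_adj T _]/(star T _) TT bopZ Tb scalerA.
rewrite -[ip _ _]/(l2_ip _ _) ip_basis.
by rewrite /dot; case: (x k) => p q; case: c => r s /=; ring.
Qed.

End Coordinates.

(** * The canonical representation on the square-summable sequences over Z *)

Section CanonicalRepresentation.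
Variable R : realType.
Notation H := (l2_hilbert R (0 : int)).
Notation l2 := (l2 R int).

Fact shift_pbijP (i j : int) : Some (i + 1) = Some j <-> Some (j - 1) = Some i.
Proof. by split=> -[] <-; congr Some; lia. Qed.
Definition shift_pbij := Pbij shift_pbijP.

Fact double_pbijP (i j : int) :
  Some (2 * i) = Some j <->
  (if (j %% 2)%Z == 0 then Some (j %/ 2)%Z else None) = Some i.
Proof.
split=> [[<-]|].
  by rewrite mulrC modzMl eqxx mulzK.
by case: ifPn => // /eqP j0 [<-]; congr Some; lia.
Qed.
Definition double_pbij := Pbij double_pbijP.

Fact halfline_pbijP (i j : int) :
  (if 0 <= i then Some i else None) = Some j <->
  (if 0 <= j then Some j else None) = Some i.
Proof. by split; case: ifPn => // h [<-]; rewrite h. Qed.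
Definition halfline_pbij := Pbij halfline_pbijP.

Definition shift_op : bop H := pbij_op R 0 shift_pbij.
Definition double_op : bop H := pbij_op R 0 double_pbij.
Definition halfline_proj : bop H := pbij_op R 0 halfline_pbij.
Definition ket (k : int) : H := l2_basis R k.

Lemma canonical_Q2_relations : Q2_relations shift_op double_op.
Proof.
split.
- by split; apply: bop_ext => x; apply: l2_ext => k;
    rewrite [LHS]/= ?addrK ?subrK.
- apply: bop_ext => x; apply: l2_ext => k.
  by rewrite [LHS]/= mulrC modzMl eqxx /= mulzK.
- apply: bop_ext => x; apply: l2_ext => k /=.
  have -> : ((k - 1 - 1) %% 2)%Z = (k %% 2)%Z by lia.
  case: ifPn => //= k2; congr (l2_val x _); lia.
- apply: bop_ext => x; apply: l2_ext => k.
  have -> : (((double_op * star double_op + shift_op * double_op * star double_op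
     * star shift_op) x : l2) k) =
    ((double_op (star double_op x) : l2) k +
     (shift_op (double_op (star double_op (star shift_op x))) : l2) k) by [].
  rewrite /=; case: ifPn => /= h1; case: ifPn => /= h2.
  + by lia.
  + by rewrite addr0; congr (l2_val x _); lia.
  + by rewrite add0r; congr (l2_val x _); lia.
  + by lia.
Qed.

Lemma star_halfline_proj : star halfline_proj = halfline_proj.
Proof. by apply: bop_ext => x; apply: l2_ext. Qed.

Lemma halfline_projE (x : H) k :
  (halfline_proj x : l2) k = if 0 <= k then (x : l2) k else 0.
Proof. by rewrite /=; case: ifP. Qed.

Lemma halfline_proj_idem : halfline_proj * halfline_proj = halfline_proj.
Proof.
apply: bop_ext => x; apply: l2_ext => k.
by rewrite /=; case: ifPn => //= ->.
Qed.

Lemma double_halfline_comm :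
  double_op * halfline_proj = halfline_proj * double_op.
Proof.
apply: bop_ext => x; apply: l2_ext => k /=.
by do ?case: ifPn => //=; lia.
Qed.

Lemma odd_halfline_comm : shift_op * double_op * halfline_proj =
  halfline_proj * (shift_op * double_op).
Proof.
apply: bop_ext => x; apply: l2_ext => k /=.
by do ?case: ifPn => //=; lia.
Qed.

Lemma shift_basis k : shift_op (ket k) = ket (k + 1).
Proof. exact: pbij_op_basis. Qed.

Lemma double_basis k : double_op (ket k) = ket (2 * k).
Proof. exact: pbij_op_basis. Qed.

Lemma halfline_basis k : halfline_proj (ket k) = if 0 <= k then ket k else 0.
Proof. by rewrite /ket pbij_op_basis /=; case: ifP. Qed.

(** The shift carries e_(-1) into the range of the projection. *)
Lemma shift_halfline_not_comm :
  shift_op * halfline_proj <> halfline_proj * shift_op.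
Proof.
move=> /(congr1 (fun T : bop H => T (ket (-1)))) E.
have {E} : shift_op (halfline_proj (ket (-1))) =
  halfline_proj (shift_op (ket (-1))) by exact: E.
rewrite shift_basis !halfline_basis bop0 => /(congr1 (fun x : l2 => x 0)) /eqP.
by rewrite /= eq_sym oner_eq0.
Qed.

(** The coordinates of a fixed vector vanish at odd k and satisfy x_(2k) = x_k,
so x_k = 0 for k <> 0 by descent on |k|. *)
Lemma double_fixed (x : H) : double_op x = x -> x = ((x : l2) 0) *: ket 0.
Proof.
move=> xx; have step (k : int) : (x : l2) k =
    if (k %% 2)%Z == 0 then (x : l2) (k %/ 2)%Z else 0.
  by rewrite -{1}xx /=; case: ifP.
have x0 n (k : int) : (`|k| <= n)%N -> k != 0 -> (x : l2) k = 0.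
  elim: n k => [|n IHn] k; first by lia.
  move=> kn k0; rewrite step; case: ifPn => // k2; apply: IHn; lia.
apply: l2_ext => k; rewrite l2Z /=; have [->|k0] := eqVneq k 0.
  by rewrite mulr1.
by rewrite mulr0; exact: x0 k0.
Qed.

(** The same descent around -1, the fixed point of k -> 2k + 1: the quantity
|k + 1| is halved. *)
Lemma odd_fixed (x : H) : shift_op (double_op x) = x ->
  x = ((x : l2) (-1)) *: ket (-1).
Proof.
move=> xx; have step (k : int) : (x : l2) k =
    if ((k - 1) %% 2)%Z == 0 then (x : l2) ((k - 1) %/ 2)%Z else 0.
  by rewrite -{1}xx /=; case: ifP.
have x0 n (k : int) : (`|(k + 1)%R| <= n)%N -> k != -1 -> (x : l2) k = 0.
  elim: n k => [|n IHn] k; first by lia.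
  move=> kn k0; rewrite step; case: ifPn => // k2; apply: IHn; lia.
apply: l2_ext => k; rewrite l2Z /=; have [->|k0] := eqVneq k (-1).
  by rewrite mulr1.
by rewrite mulr0; exact: x0 k0.
Qed.

(** An operator commuting with the generators of O_2 preserves their fixed
lines, spanned by e_0 and e_(-1).  Binary expansion writes every other e_k as the image
under doubling or doubling-plus-one of a basis vector on the same side of 0,
which propagates the two eigenvalues. *)
Lemma commutant_diag (q : bop H) :
  q * double_op = double_op * q ->
  q * (shift_op * double_op) = shift_op * double_op * q ->
  exists a b : R[i], forall k, q (ket k) = (if 0 <= k then a else b) *: ket k.
Proof.
move=> q2 q1.
have q2E x : q (double_op x) = double_op (q x).
  by rewrite -[LHS]/((q * double_op) x) q2.
have q1E x : q (shift_op (double_op x)) = shift_op (double_op (q x)).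
  by rewrite -[LHS]/((q * (shift_op * double_op)) x) q1.
exists ((q (ket 0) : l2) 0), ((q (ket (-1)) : l2) (-1)).
have q0 : q (ket 0) = ((q (ket 0) : l2) 0) *: ket 0.
  by apply: double_fixed; rewrite -q2E double_basis mulr0.
have qm1 : q (ket (-1)) = ((q (ket (-1)) : l2) (-1)) *: ket (-1).
  by apply: odd_fixed; rewrite -q1E double_basis shift_basis.
set a := (q (ket 0) : l2) 0; set b := (q (ket (-1)) : l2) (-1).
rewrite -/a in q0; rewrite -/b in qm1.
suff ind n k : (`|k| <= n)%N -> q (ket k) = (if 0 <= k then a else b) *: ket k.
  by move=> k; exact: ind (leqnn _).
elim: n k => [|n IHn] k kn.
  by have -> : k = 0 by lia.
have [->|k0] := eqVneq k 0; first by [].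
have [->|km1] := eqVneq k (-1); first by [].
have kE : k = 2 * (k %/ 2)%Z \/ k = 2 * (k %/ 2)%Z + 1 by lia.
have IHk := IHn (k %/ 2)%Z; have kn2 : (`|(k %/ 2)%Z| <= n)%N by lia.
have sgnE : (0 <= (k %/ 2)%Z) = (0 <= k) by apply/idP/idP; lia.
rewrite sgnE in IHk; case: kE => kE.
  by rewrite kE -double_basis q2E IHk// bopZ -kE.
by rewrite kE -shift_basis -double_basis q1E IHk// !bopZ -kE.
Qed.

Notation p := halfline_proj.
Implicit Types w q : bop H.

(** The commutator has rank one: only e_(-1) is moved across the boundary. *)
Lemma shift_halfline_commutator (x : H) :
  (shift_op * p - p * shift_op) x = - (x : l2) (-1) *: ket 0.
Proof.
apply: l2_ext => k.
rewrite l2Z -[LHS]/((shift_op (p x) : l2) k - (p (shift_op x) : l2) k) /=.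
have [->|k0] := eqVneq k 0; first by rewrite /= sub0r mulr1.
rewrite mulr0; case: ifPn => h1; case: ifPn => h2 /=; rewrite ?subrr//; lia.
Qed.

Lemma weakly_null_coord (x : nat -> H) k : weakly_null x ->
  sqn ((x n : l2) k) @[n --> \oo] --> (0 : R).
Proof.
move=> x0; have xc c : dot ((x n : l2) k) c @[n --> \oo] --> (0 : R).
  by under eq_fun do rewrite -ip_basis; exact: (x0 (c *: ket k)).
have re0 := xc 1; have im0 := xc (Complex 0 1).
rewrite (_ : (fun n => _) = (fun n =>
    dot ((x n : l2) k) 1 * dot ((x n : l2) k) 1
    + dot ((x n : l2) k) (Complex 0 1) * dot ((x n : l2) k) (Complex 0 1))); last first.
  by apply/funext => n; rewrite /sqn /dot /= !mulr0 !mulr1 addr0 add0r !expr2.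
have h := cvgD (cvgM re0 re0) (cvgM im0 im0); rewrite mulr0 addr0 in h.
exact: h.
Qed.

Lemma shift_essentially_commutes :
  completely_continuous (shift_op * p - p * shift_op).
Proof.
move=> x _ x0; apply: cvg0_sqr.
rewrite (_ : (fun n => _) = (fun n => sqn ((x n : l2) (-1)))).
  exact: weakly_null_coord.
apply/funext => n; rewrite shift_halfline_commutator hnormZ hnorm_basis mulr1.
by rewrite normcE_sqn sqr_sqrtr ?sqn_ge0// /sqn !raddfN /= !sqrrN.
Qed.

Lemma basis_weakly_null : weakly_null (fun n => ket n%:Z).
Proof.
(* Coordinates of a square-summable family are terms of a convergent series. *)
move=> y; have sq0 : sqn ((y : l2) (Posz n)) @[n --> \oo] --> (0 : R).
  apply: cvg_series_cvg_0; apply: nondecreasing_is_cvgn.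
    by apply: nondecreasing_series => n _ _; exact: sqn_ge0.
  exists (nsum (fun i => sqn ((y : l2) i))) => _ [n _ <-].
  rewrite -lee_fin nsumEFin; last exact: asum_sqn; last first.
    by move=> i; exact: sqn_ge0.
  rewrite /series /= -[X in (X%:E <= _)%E](big_map Posz xpredT
    (fun i => sqn ((y : l2) i))).
  apply: esumR_sum => [i|]; first exact: sqn_ge0.
  by rewrite map_inj_uniq ?iota_uniq// => i j [].
apply: cvg0_sqr; apply: (@squeeze0 _ _ (fun n => sqn ((y : l2) (Posz n)))) => // n.
rewrite sqr_ge0 ipC -[ket _]scale1r -[ip _ _]/(l2_ip _ _) ip_basis /dot /sqn /=.
by rewrite mulr1 mulr0 addr0 lerDl sqr_ge0.
Qed.

Lemma isometry_hnorm w (x : H) : star w * w = 1 -> hnorm (w x) = hnorm x.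
Proof.
by move=> ww; rewrite /hnorm bop_ip -[bop_adj w _]/((star w * w) x) ww.
Qed.

(** If w exchanged the projection and its complement, the commutator would be
w (2 p - 1), which is isometric on the weakly null sequence e_0, e_1, ... *)
Lemma unitary_no_swap w :
  star w * w = 1 -> completely_continuous (w * p - p * w) ->
  w * p <> (1 - p) * w.
Proof.
move=> ww wc wp.
have we n : (w * p - p * w) (ket (Posz n)) = w (ket (Posz n)).
  have -> : w * p - p * w = w * (p + p - 1).
    rewrite mulrBr mulrDr mulr1 -addrA; congr (_ + _).
    by rewrite wp mulrBl mul1r addrAC subrr sub0r.
  rewrite -[LHS]/(w (p (ket (Posz n)) + p (ket (Posz n)) - ket (Posz n))).
  by rewrite halfline_basis addrK.
have := wc (fun n => ket (Posz n)).
have bnd : bounded_seq (fun n => ket (Posz n)).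
  by exists 1 => n; rewrite hnorm_basis.
move=> /(_ bnd basis_weakly_null).
under eq_fun do rewrite we isometry_hnorm// hnorm_basis.
move=> /(cvg_lim (@Rhausdorff R)); rewrite lim_cst; last exact: Rhausdorff.
by move/eqP; rewrite oner_eq0.
Qed.

Lemma halfline_proj_nontrivial (a : R[i]) : p <> a *: 1.
Proof.
move=> pa; (* A scalar projection would have the same eigenvalue on e_0 and e_(-1). *)
have pE (k : int) : (if 0 <= k then ket k else 0) = a *: ket k.
  by rewrite -halfline_basis pa.
have := congr1 (fun x : l2 => x 0) (pE 0).
have := congr1 (fun x : l2 => x (-1)) (pE (-1)).
rewrite !l2Z /= mulr1 => <- /eqP.
by rewrite oner_eq0.
Qed.

(** The conjugate q of the projection is diagonal with eigenvalue a on k >= 0 and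
b on k < 0, each 0 or 1.  Equal values would make the projection scalar, and
(a, b) = (0, 1) is the excluded exchange, so q is the projection itself. *)
Lemma conjugate_commutes w : unitary_elt w ->
  completely_continuous (w * p - p * w) ->
  let q := w * p * star w in
  q * double_op = double_op * q ->
  q * (shift_op * double_op) = shift_op * double_op * q ->
  w * p = p * w.
Proof.
move=> [w1 w2] wc q q2 q1.
have qq : q * q = q.
  by rewrite /q !mulrA -[_ * star w * w]mulrA w1 mulr1 -[w * p * p]mulrA
    halfline_proj_idem.
have qs : star q = q by rewrite /q !starM starK star_halfline_proj mulrA.
have qw : q * w = w * p by rewrite /q -mulrA w1 mulr1.
have [a [b qE]] := commutant_diag q2 q1.
have idem (k : int) (c : R[i]) : q (ket k) = c *: ket k -> c = 0 \/ c = 1.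
  move=> qk; have : q (q (ket k)) = q (ket k) by rewrite -[LHS]/((q * q) (ket k)) qq.
  rewrite qk bopZ qk scalerA => /(congr1 (fun x : l2 => x k)).
  rewrite !l2Z /= eqxx !mulr1 => /eqP.
  rewrite -subr_eq0 -{3}[c]mulr1 -mulrBr mulf_eq0 subr_eq0.
  by case/orP => /eqP; [left | right].
have real01 (c : R[i]) : c = 0 \/ c = 1 -> exists r : R, c = r%:C.
  by case=> ->; [exists 0 | exists 1].
have [ha hb] := (idem 0 a (qE 0), idem (-1) b (qE (-1))).
have [[ra aE] [rb bE]] := (real01 _ ha, real01 _ hb).
(* The eigenvalues are real, as [diag_eigen] requires. *)
have qx (x : H) (k : int) : (q x : l2) k = (if 0 <= k then a else b) * (x : l2) k.
  rewrite (@diag_eigen _ _ _ q (fun k : int => if 0 <= k then ra else rb))//.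
    by rewrite aE bE; case: ifP.
  by move=> j; rewrite qE aE bE; case: ifP.
have scalar : a <> b.
  move=> ab; apply: (@halfline_proj_nontrivial a).
  have qa : q = a *: 1.
    by apply: bop_ext => x; apply: l2_ext => k; rewrite qx -ab l2Z; case: ifP.
  have : star w * (q * w) = a *: 1 by rewrite qa -scalerAl mul1r -scalerAr w1.
  by rewrite qw mulrA w1 mul1r.
case: ha hb => a01 [] b01; rewrite a01 b01// in scalar qx.
(* q = 1 - p, that is, w exchanges the projection and its complement. *)
- exfalso; apply: (unitary_no_swap w1 wc); rewrite -qw; congr (_ * _).
  apply: bop_ext => x; apply: l2_ext => k.
  rewrite qx -[RHS]/((x : l2) k - (p x : l2) k) halfline_projE.
  by case: ifP; rewrite ?mul0r ?mul1r ?subrr ?subr0.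
- rewrite -qw; congr (_ * _); apply: bop_ext => x; apply: l2_ext => k.
  by rewrite qx halfline_projE; case: ifP; rewrite ?mul0r ?mul1r.
Qed.

End CanonicalRepresentation.

Theorem theorem7p4 (R : realType) (Q : cstarAlgType R) (U S2 : Q)
    (hQ : is_Q2 U S2) :
  cstar_generated (unitary_normalizer (O2 U S2)) `<` [set: Q].
Proof.
have [_ generated universal] := hQ.
have [f [f_star fU fS]] :=
  universal _ _ _ (canonical_Q2_relations R).
have f_le := star_hom_contractive f_star.
have fM x y : f (x * y) = f x * f y := rmorphM f x y.
have f1 : f 1 = 1 := rmorph1 f.
set p := halfline_proj R; have ps := star_halfline_proj R : star p = p.
(* The rank-one commutator of the shift makes [f x, p] compact on generators. *)
have f_ess x : completely_continuous (f x * p - p * f x).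
  have sub : cstar_generated [set U; S2] `<=`
      f @^-1` [set T | completely_continuous (T * p - p * T)].
    apply: smallest_sub.
      exact: preimage_cstar f_star f_le (essential_commutant_cstar ps).
    move=> _ [] -> /=; first by rewrite fU; exact: shift_essentially_commutes.
    by rewrite fS double_halfline_comm subrr; exact: completely_continuous0.
  by apply: sub; rewrite generated.
have comm := preimage_cstar f_star f_le (commutant_cstar ps).
have O2_comm : O2 U S2 `<=` f @^-1` [set T | T * p = p * T].
  apply: smallest_sub => // _ [] -> /=.
    by rewrite fM fU fS; exact: odd_halfline_comm.
  by rewrite fS; exact: double_halfline_comm.
split=> // all_gen.
have : cstar_generated (unitary_normalizer (O2 U S2)) `<=`
    f @^-1` [set T | T * p = p * T].
  apply: smallest_sub => // v [[v1 v2] vO2] /=.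
  have w1 : star (f v) * f v = 1 by rewrite -f_star -fM v1 f1.
  have w2 : f v * star (f v) = 1 by rewrite -f_star -fM v2 f1.
  (* Writing y = v x v* with x in O_2, the factor f x slides through p. *)
  have q_comm y : O2 U S2 y ->
      f v * p * star (f v) * f y = f y * (f v * p * star (f v)).
    rewrite -{1}vO2 => -[x /O2_comm /= xp <-].
    rewrite !fM f_star !mulrA -[_ * star (f v) * f v]mulrA w1 mulr1.
    rewrite -[_ * star (f v) * f v]mulrA w1 mulr1.
    by rewrite -[f v * p * f x]mulrA -xp mulrA.
  apply: conjugate_commutes => //.
    by rewrite -fS; apply: q_comm; apply: sub_gen_smallest; right.
  by rewrite -fU -fS -fM; apply: q_comm; apply: sub_gen_smallest; left.
move=> /(_ U) /=; rewrite fU => comm_shift.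
by apply: (@shift_halfline_not_comm R); apply: comm_shift; exact: all_gen.
Qed.
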